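(* For every $\epsilon>0$ and $c\in[0,1]$, there is a (randomized) polynomial-time algorithm that, given value-oracle access to a monotone nondecreasing submodular function $f:2^X\to\mathbb{R}_{\ge0}$ of total curvature (at most) $c$ and a matroid $\mathcal{M}=(X,\mathcal{I})$, produces a set $S\in\mathcal{I}$ satisfying, with high probability, $$f(S)\ \ge\ (1-c/e-O(\epsilon))\,f(O)\quad\text{for every } O\in\mathcal{I}.$$
   Context: For $A\subseteq X$ and $j\in X\setminus A$, write $f_A(j)=f(A\cup\{j\})-f(A)$. The total curvature of a nondecreasing submodular $f$ is $c=\max_{j\in X}\frac{f_\emptyset(j)-f_{X\setminus\{j\}}(j)}{f_\emptyset(j)}=1-\min_{j\in X}\frac{f_{X\setminus\{j\}}(j)}{f_\emptyset(j)}$. $O(\epsilon)$ denotes a quantity bounded by an absolute constant times $\epsilon$. Submodular: $f(A)+f(B)\ge f(A\cap B)+f(A\cup B)$ for all $A,B$. *)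

(* Defs.v *)
From HB Require Import structures.
From mathcomp Require Import all_boot all_order all_algebra.
From mathcomp Require Import reals.

Set Implicit Arguments.
Unset Strict Implicit.
Unset Printing Implicit Defensive.

Import Order.TTheory GRing.Theory Num.Theory.

Local Open Scope ring_scope.

Section SetFunctions.
Variables (R : realType) (X : finType).
Implicit Types (f : {set X} -> R) (I : {set {set X}}).

Definition nonneg f : Prop := forall A, 0 <= f A.

Definition nondecreasing_set f : Prop :=
  forall A B : {set X}, A \subset B -> f A <= f B.

Definition submodular f : Prop :=
  forall A B : {set X}, f (A :&: B) + f (A :|: B) <= f A + f B.

Definition marginal f (A : {set X}) (j : X) : R := f (j |: A) - f A.

(* If [f] is nondecreasing and submodular, every quotient lies in [0, 1], so  *)
(* the base value 0 only matters when [X] is empty.  An element with          *)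
(* [marginal f set0 j = 0] also has last marginal 0: its quotient reads 0 / 0 *)
(* and, since [0 / 0 = 0], it does not contribute to the curvature.           *)
Definition curvature f : R :=
  \big[Num.max/0]_(j : X)
    ((marginal f set0 j - marginal f (~: [set j]) j) / marginal f set0 j).

Definition matroid I : Prop :=
  [/\ set0 \in I,
      forall A B : {set X}, A \subset B -> B \in I -> A \in I &
      forall A B : {set X}, A \in I -> B \in I -> (#|A| < #|B|)%N ->
        exists2 x, x \in B :\: A & x |: A \in I].

End SetFunctions.

(* Algorithms are programs of a probabilistic real RAM with a value oracle    *)
(* and an independence oracle.  There is one bank of natural-number cells and *)
(* one bank of real cells, both addressed indirectly.  Real cells hold exact  *)
(* reals, with unit-cost field operations and comparisons, rational constants *)
(* only, and no rounding to integers.  Natural-number cells have no           *)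
(* multiplication, so that the bit length of their contents is at most linear *)
(* in the running time.                                                       *)

Inductive nexp : Type :=
| NConst of nat
| NCell of nexp
| NAdd of nexp & nexp
| NSub of nexp & nexp.

Inductive rexp : Type :=
| RConst of rat
| RCell of nexp
| ROfNat of nexp
| RAdd of rexp & rexp
| RSub of rexp & rexp
| RMul of rexp & rexp
| RDiv of rexp & rexp.

Inductive bexp : Type :=
| BLeN of nexp & nexp
| BLeR of rexp & rexp
| BNot of bexp
| BAnd of bexp & bexp.

(* In [Value a b] and [Indep a b], the result goes to cell [a], and the query *)
(* is the set whose characteristic vector starts at address [b].              *)
Inductive cmd : Type :=
| Skip
| NSet of nexp & nexp
| RSet of nexp & rexp
| Value of nexp & nexp
| Indep of nexp & nexp
| Flip of nexp
| Seq of cmd & cmd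
| If of bexp & cmd & cmd
| While of bexp & cmd.

Section Machine.
Variables (R : realType) (X : finType).
Variables (f : {set X} -> R) (I : {set {set X}}).

(* [tape] lists the coin tosses that are still unread. *)
Record state : Type := State {
  nmem : nat -> nat;
  rmem : nat -> R;
  tape : seq bool
}.

Implicit Types (s : state) (m : nat -> nat).

(* The element of rank [i] in the enumeration of [X] belongs to the set       *)
(* encoded at address [a] iff cell [a + i] is nonzero.                        *)
Definition set_at m (a : nat) : {set X} :=
  [set x | m (a + enum_rank x)%N != 0%N].

Fixpoint neval m (e : nexp) : nat :=
  match e with
  | NConst k => k
  | NCell e1 => m (neval m e1)
  | NAdd e1 e2 => neval m e1 + neval m e2
  | NSub e1 e2 => neval m e1 - neval m e2
  end%N.

Fixpoint reval s (e : rexp) : R :=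
  match e with
  | RConst q => ratr q
  | RCell e1 => rmem s (neval (nmem s) e1)
  | ROfNat e1 => (neval (nmem s) e1)%:R
  | RAdd e1 e2 => reval s e1 + reval s e2
  | RSub e1 e2 => reval s e1 - reval s e2
  | RMul e1 e2 => reval s e1 * reval s e2
  | RDiv e1 e2 => reval s e1 / reval s e2
  end.

Fixpoint beval s (b : bexp) : bool :=
  match b with
  | BLeN e1 e2 => (neval (nmem s) e1 <= neval (nmem s) e2)%N
  | BLeR e1 e2 => reval s e1 <= reval s e2
  | BNot b1 => ~~ beval s b1
  | BAnd b1 b2 => beval s b1 && beval s b2
  end.

Definition nwrite s (a v : nat) : state :=
  State [eta nmem s with a |-> v] (rmem s) (tape s).

Definition rwrite s (a : nat) (v : R) : state :=
  State (nmem s) [eta rmem s with a |-> v] (tape s).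

(* A configuration is the stack of commands still to be executed, together    *)
(* with the memory; the machine has halted when the stack is empty.           *)
Definition config : Type := (seq cmd * state)%type.

Definition step (cf : config) : config :=
  let: (k, s) := cf in
  let ev := neval (nmem s) in
  match k with
  | [::] => cf
  | Skip :: k' => (k', s)
  | NSet a e :: k' => (k', nwrite s (ev a) (ev e))
  | RSet a e :: k' => (k', rwrite s (ev a) (reval s e))
  | Value a b :: k' => (k', rwrite s (ev a) (f (set_at (nmem s) (ev b))))
  | Indep a b :: k' =>
      (k', nwrite s (ev a) (set_at (nmem s) (ev b) \in I))
  | Flip a :: k' =>
      (k', nwrite (State (nmem s) (rmem s) (behead (tape s)))
             (ev a) (head false (tape s)))
  | Seq c1 c2 :: k' => (c1 :: c2 :: k', s)
  | If b c1 c2 :: k' => ((if beval s b then c1 else c2) :: k', s)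
  | While b c :: k' => (if beval s b then c :: k else k', s)
  end.

(* On input, natural-number cell 0 holds [#|X|] and every other cell holds 0. *)
Definition init (P : cmd) (r : seq bool) : config :=
  ([:: P], State [eta (fun=> 0%N) with 0%N |-> #|X|] (fun=> 0) r).

Definition run (P : cmd) (T : nat) (r : seq bool) : config :=
  iter T step (init P r).

Definition halted (cf : config) : bool := nilp cf.1.

(* On output, natural-number cell 0 holds the address of the result. *)
Definition output (cf : config) : {set X} :=
  set_at (nmem cf.2) (nmem cf.2 0%N).

End Machine.

(* Probability of [E] under [T] independent fair coin tosses.  A run of [T]   *)
(* steps reads at most [T] tosses.                                            *)
Definition coin_prob (R : realType) (T : nat) (E : pred (T.-tuple bool)) : R :=
  #|[set r | E r]|%:R / 2 ^+ T.

(* Main.v *)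
(* The algorithm is a deterministic non-oblivious local search in the style of *)
(* Buchbinder and Feldman.  Every element of the current independent set A    *)
(* carries one of L labels; S_J is the set of elements with a label in J.     *)
(* Write l(x) = f(X) - f(X - x), extended additively, and g = f - l, which is *)
(* again nonnegative, nondecreasing and submodular.  With q = 1 + 1/L and     *)
(* w_k = q^k / (k C(L, k)), the search climbs the potential                   *)
(*   sum_J w_|J| g(S_J) + q^(L+1) l(A)                                        *)
(* by moves that drop an element u and insert an element v with a label j.    *)
(* Summing the changes over all labels j and all pairs (u, v) of a matching   *)
(* between A and O given by the exchange axiom, the weights make all terms    *)
(* g(S_J) cancel but those of J empty and J full.  At a local optimum this    *)
(* leaves                                                                     *)
(*   f(A) >= f(O) - q^(-L) (f(O) - f({}) - l(O)) - error,                     *)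
(* where f(O) - f({}) - l(O) <= c f(O) by the definition of the curvature and *)
(* q^(-L) <= 1/e + 1/L.  The linear part l enters the potential with its own  *)
(* coefficient, so neither c nor l(O) has to be guessed.  A move is accepted  *)
(* when it gains more than M / (L |X|^2), where M is f({}) plus the sum of f  *)
(* over independent singletons; as M bounds f on independent sets, O(|X|^2)   *)
(* passes reach a local optimum, and as M <= (|X| + 1) max f, the error is at *)
(* most (2/L) max f.                                                          *)

(* The guarantee is an averaging argument. Suppose no move raises the potential of the current
   labelled set A by more than tau, and let O be independent. [indep_matching] gives every v in O a
   partner h(v), no partner being used twice, such that A stays independent when v replaces h(v).
   Each such move, with each of the L labels for v, gains at most tau. By submodularity
   ([potential_relabel]) the gain is at least what inserting v brings minus what deleting h(v)
   costs. Summed over v and over labels, these bounds compare g(O) with all the g(S_J), and the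
   weights are tuned so that the sum collapses over the lattice of label sets ([weight_identity]).
   The linear part then recombines with g into f, which gives [local_optimum_bound]. [curvature_le]
   and [inv_growth_le] turn this into the ratio, in [final_labelling_bound].

   The potential of an independent labelling lies between 0 and M times a constant depending on L,
   and a pass that starts away from a local optimum gains more than tau. Hence a number of passes
   fixed in advance suffices ([iter_search_pass], [final_labelling_opt]).

   On the machine, every loop of [local_search] ranges over X, while L and B only lengthen the
   program text. So the polynomial time bound is read off the syntax ([running_time_poly]), and the
   logic [wp] shows that the output is [final_labelling] ([wp_local_search]). No coin is tossed, so
   success has probability 1. *)
Require Import Defs.
From HB Require Import structures.
From mathcomp Require Import all_boot all_order all_algebra.
From mathcomp Require Import reals sequences exp.
From mathcomp Require Import ring lra zify.

Set Implicit Arguments.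
Unset Strict Implicit.
Unset Printing Implicit Defensive.

Import Order.TTheory GRing.Theory Num.Theory.

Local Open Scope ring_scope.

(** * Matchings between independent sets *)

Section Matroid.
Variables (X : finType) (I : {set {set X}}).
Hypothesis matI : matroid I.
Implicit Types A B O : {set X}.

Lemma indep_sub A B : A \subset B -> B \in I -> A \in I.
Proof. by case: matI => _ h _; apply: h. Qed.

Lemma indep_extend A B : A \in I -> B \in I -> (#|A| <= #|B|)%N ->
  exists C, [/\ C \in I, A \subset C, C \subset A :|: B & #|C| = #|B|].
Proof.
move: {2}(#|B| - #|A|)%N (erefl (#|B| - #|A|)%N) => k.
elim: k A => [|k IH] A Ek AI BI leAB.
  by exists A; rewrite subxx subsetUl AI; split=> //; lia.
have [_ _ aug] := matI.
have [|x /setDP[xB xA] xAI] := aug A B AI BI; first by lia.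
have cx : #|x |: A| = #|A|.+1 by rewrite cardsU1 xA.
have [||||C [CI sAC sCU cC]] := IH (x |: A) => //; try lia.
exists C; split=> //; first exact: subset_trans (subsetUr _ _) sAC.
apply: subset_trans sCU _; rewrite subUset subsetUr andbT subUset subsetUl andbT.
by rewrite sub1set inE xB orbT.
Qed.

(** A circuit-free proof. Let B be the part of O spanned by A - x. Then x + B is independent,
    because x is not spanned by A - x. Extending x + B within O to size |O| leaves out exactly one y
    of O, which is outside B and therefore also fits into A - x. *)
Lemma indep_symmetric_exchange A O x :
  A \in I -> O \in I -> #|A| = #|O| -> x \in A :\: O ->
  exists2 y, y \in O :\: A & (y |: (A :\ x) \in I) && (x |: (O :\ y) \in I).
Proof.
move=> AI OI eqAO /setDP[xA xO].
have [_ _ aug] := matI.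
have cAx : #|A| = #|A :\ x|.+1 by rewrite (cardsD1 x) xA.
have AxI : A :\ x \in I by apply: indep_sub AI; apply: subsetDl.
(* the elements of O spanned by A :\ x *)
pose B := [set y in O | (y \in A) || (y |: (A :\ x) \notin I)].
have BO : B \subset O by apply/subsetP => y; rewrite inE => /andP[].
have BI : B \in I by apply: indep_sub OI.
have xB : x \notin B by apply: contra xO; apply: (subsetP BO).
have xBI : x |: B \in I.
  have spanned C : C \in I -> C \subset B :|: (A :\ x) -> (#|C| <= #|A :\ x|)%N.
    move=> CI sC; rewrite leqNgt; apply/negP => ltC.
    have [z /setDP[zC zAx] zI] := aug _ _ AxI CI ltC.
    have := subsetP sC z zC; rewrite inE (negPf zAx) orbF inE zI /= orbF.
    case/andP=> zO zA; move: zAx; rewrite !inE zA andbT negbK => /eqP zx.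
    by rewrite -zx zO in xO.
  have leB : (#|B| <= #|A :\ x|)%N by apply: spanned => //; apply: subsetUl.
  have [C [CI sBC sCU cC]] := indep_extend BI AxI leB.
  have [|z /setDP[zA zC] zI] := aug C A CI AI; first by rewrite cC cAx.
  have [zx|zx] := eqVneq z x.
    by apply: indep_sub zI; rewrite zx; apply: setUS.
  have /(spanned _ zI) : z |: C \subset B :|: (A :\ x).
    by rewrite subUset sCU andbT sub1set !inE zx zA orbT.
  by rewrite cardsU1 zC cC /= ltnn.
have leBO : (#|x |: B| <= #|O|)%N.
  rewrite cardsU1 xB add1n; apply: proper_card; rewrite properE BO /=.
  apply/negP => sOB.
  have sOI : x |: O \in I by apply: indep_sub xBI; apply: setUS.
  have [|z /setDP[]] := aug (A :\ x) O AxI OI; first by lia.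
  move=> zO zAx zI; have := subsetP sOB z zO; rewrite inE zO zI orbF /=.
  move=> zA; move: zAx; rewrite !inE zA andbT negbK => /eqP zx.
  by rewrite -zx zO in xO.
have [C [CI sBC sCU cC]] := indep_extend xBI OI leBO.
have xC : x \in C by apply: (subsetP sBC); rewrite !inE eqxx.
have sCx : C :\ x \subset O.
  apply/subsetP => z /setD1P[zx zC]; have := subsetP sCU z zC.
  by rewrite !inE (negPf zx) /= => /orP[/andP[]|].
have cCx : #|O| = #|C :\ x|.+1 by rewrite -cC (cardsD1 x) xC.
have [y yO yC] : exists2 y, y \in O & y \notin C :\ x.
  by apply/subsetPn/negP => /subset_leq_card; rewrite cCx ltnn.
have yx : y != x by apply: contraNneq xO => <-.
have yB : y \notin B.
  by apply: contra yC => yB; rewrite in_setD1 yx; apply: (subsetP sBC); rewrite in_setU yB orbT.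
move: yB; rewrite inE yO /= negb_or negbK => /andP[yA yI].
exists y; first by rewrite inE yA.
rewrite yI /=.
suff <- : C = x |: (O :\ y) by [].
have eC : C :\ x = O :\ y.
  apply/eqP; rewrite eqEcard subsetD1 sCx yC /=.
  by move: cCx; rewrite (cardsD1 y O) yO add1n => -[<-].
by rewrite -eC setD1K.
Qed.

(* An unmatched [v] has [h v = v]: replacing it amounts to adding it to [A].  *)
Lemma indep_matching A O : A \in I -> O \in I ->
  exists h : X -> X,
    [/\ {in O &, injective h},
        forall v, v \in O -> (h v == v) || (h v \in A :\: O) && (v \notin A) &
        forall v, v \in O -> v |: (A :\ h v) \in I].
Proof.
move=> AI.
move: {2}#|O :\: A| (erefl #|O :\: A|) => k.
elim: k O => [|k IH] O Ek OI.
  have sOA : O \subset A by rewrite -setD_eq0 -cards_eq0 Ek.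
  exists id; split=> //= v vO; first by rewrite eqxx.
  by rewrite setD1K // (subsetP sOA).
have [_ _ aug] := matI.
have [ltAO|leOA] := ltnP #|A| #|O|.
  (* Here some y of O can be added to A without any deletion, so it becomes its own partner. *)
  have [y yOA yI] := aug _ _ AI OI ltAO; have /setDP[yO yA] := yOA.
  have [||h [injh hA hI]] := IH (O :\ y).
  - by move: Ek; rewrite (cardsD1 y) yOA add1n setDDl setUC -setDDl => -[].
  - by apply: indep_sub OI; apply: subsetDl.
  have hy v : v \in O :\ y -> h v != y.
    move=> vOy; have /setD1P[vy vO] := vOy.
    case/orP: (hA v vOy) => [/eqP-> //|/andP[/setDP[hvA _] _]].
    by apply: contraNneq yA => <-.
  have Oy v : v \in O -> v != y -> v \in O :\ y by move=> *; rewrite !inE; apply/andP.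
  exists (fun v => if v == y then y else h v); split=> [u v uO vO|v vO|v vO].
  - case: (eqVneq u y) => [->|uy]; case: (eqVneq v y) => [->|vy] //.
    + by move=> e; have := hy v (Oy v vO vy); rewrite -e eqxx.
    + by move=> e; have := hy u (Oy u uO uy); rewrite e eqxx.
    + by apply: injh; apply: Oy.
  - case: (eqVneq v y) => [->|vy]; first by rewrite eqxx.
    case/orP: (hA v (Oy _ vO vy)) => [->//|/andP[/setDP[hvA hvO] vA]].
    rewrite vA !inE hvA !andbT; apply/orP; right.
    apply: contra hvO => hvO; rewrite !inE hvO andbT; apply: hy; exact: Oy.
  - case: (eqVneq v y) => [->|vy]; last by apply: hI; apply: Oy.
    by apply: indep_sub yI; apply: setUS; apply: subsetDl.
have [C [CI sOC sCU cC]] := indep_extend OI AI leOA.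
have eCA : C :\: A = O :\: A.
  apply/eqP; rewrite eqEsubset [X in _ && X]setSD // andbT.
  apply/subsetP => z /setDP[zC zA]; have := subsetP sCU z zC.
  by rewrite !inE (negPf zA) orbF.
have cAC : #|A :\: C| = #|C :\: A|.
  by have := cardsID C A; have := cardsID A C; rewrite setIC; lia.
have [x xAC] : exists x, x \in A :\: C.
  by apply/set0Pn; rewrite -cards_eq0 cAC eCA Ek.
have [y yCA /andP[yI xI]] := indep_symmetric_exchange AI CI (esym cC) xAC.
have /setDP[xA xC] := xAC; have /setDP[yC yA] := yCA.
(* Trading y for x puts x into the target set, so the recursive matching cannot use x as the partner
   of an element of O, and x is free to serve y. *)
have [||h [injh hA hI]] := IH (x |: (C :\ y)) => //.
  have -> : (x |: (C :\ y)) :\: A = (O :\: A) :\ y.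
    rewrite -eCA; apply/setP => z; rewrite !inE.
    by case: eqVneq => [->|_]; rewrite ?xA ?andbF //=; case: (z == y); case: (z \in A).
  by move: Ek; rewrite (cardsD1 y) -eCA yCA eCA add1n => -[].
have Oy v : v \in O -> v != y -> v \in x |: (C :\ y).
  by move=> vO vy; rewrite !inE vy (subsetP sOC) ?orbT.
have hx v : v \in O -> v != y -> h v != x.
  move=> vO vy; case/orP: (hA v (Oy _ vO vy)) => [/eqP->|/andP[/setDP[_ +] _]].
    by apply: contraNneq xC => <-; apply: (subsetP sOC).
  by apply: contraNneq => ->; rewrite !inE eqxx.
have xO : x \notin O by apply: contra xC; apply: (subsetP sOC).
exists (fun v => if v == y then x else h v); split=> [u v uO vO|v vO|v vO].
- case: (eqVneq u y) => [->|uy]; case: (eqVneq v y) => [->|vy] //.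
  + by move=> e; have := hx v vO vy; rewrite -e eqxx.
  + by move=> e; have := hx u uO uy; rewrite e eqxx.
  + by apply: injh; apply: Oy.
- case: (eqVneq v y) => [->|vy]; first by rewrite inE xO xA yA orbT.
  case/orP: (hA v (Oy _ vO vy)) => [->//|/andP[/setDP[hvA hvO] vA]].
  rewrite vA inE hvA !andbT; apply/orP; right.
  apply: contra hvO => hvO; rewrite !inE (subsetP sOC _ hvO) andbT.
  by rewrite (_ : h v != y) ?orbT //; apply: contraTneq hvA => ->.
- by case: (eqVneq v y) => [->|vy] //; apply: hI; apply: Oy.
Qed.

End Matroid.

(** * Weights of the potential *)

Definition growth (F : numFieldType) (L : nat) : F := 1 + L%:R^-1.

(** Division by zero yields 0, so [weight] vanishes at k = 0 and the empty J contributes nothing to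
    the potential. *)
Definition weight (F : numFieldType) (L k : nat) : F :=
  growth F L ^+ k / (k%:R * 'C(L, k)%:R).

Section Weights.
Variables (F : numFieldType) (L : nat).
Hypothesis L_gt0 : (0 < L)%N.

Let L_neq0 : L%:R != 0 :> F.
Proof. by rewrite pnatr_eq0 -lt0n. Qed.

Lemma growth_gt0 : 0 < growth F L.
Proof. by rewrite ltr_wpDr // invr_ge0 ler0n. Qed.

Lemma growth_ge1 : 1 <= growth F L.
Proof. by rewrite lerDl invr_ge0 ler0n. Qed.

Lemma mulr_growth : L%:R * growth F L = L%:R + 1.
Proof. by rewrite mulrDr mulr1 divff. Qed.

Lemma weight_ge0 k : 0 <= weight F L k.
Proof.
by rewrite mulr_ge0 ?exprn_ge0 ?invr_ge0 ?mulr_ge0 ?ler0n // ltW // growth_gt0.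
Qed.

Lemma mulr_weight k : (0 < k)%N -> (k <= L)%N ->
  k%:R * weight F L k = growth F L ^+ k / 'C(L, k)%:R.
Proof.
move=> k0 kL; have kN : k%:R != 0 :> F by rewrite pnatr_eq0 -lt0n.
have cN : 'C(L, k)%:R != 0 :> F by rewrite pnatr_eq0 -lt0n bin_gt0.
by rewrite /weight; field; rewrite kN cN.
Qed.

(* The geometric growth of [k 'C(L, k) w_k] makes all levels but two cancel.  *)
Lemma weight_level k : (k <= L)%N ->
  L%:R * (k%:R * weight F L k) + k%:R * weight F L k
    - L%:R * ((L - k)%:R * weight F L k.+1) =
  if k == 0%N then - (L%:R * growth F L)
  else if k == L then L%:R * growth F L ^+ L.+1 else 0.
Proof.
move=> kL.
have next : (k < L)%N ->
    (L - k)%:R * weight F L k.+1 = growth F L ^+ k.+1 / 'C(L, k)%:R.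
  move=> ltkL.
  have cN : 'C(L, k)%:R != 0 :> F by rewrite pnatr_eq0 -lt0n bin_gt0.
  have cN' : 'C(L, k.+1)%:R != 0 :> F by rewrite pnatr_eq0 -lt0n bin_gt0.
  have kN : k.+1%:R != 0 :> F by rewrite pnatr_eq0.
  have e : k.+1%:R * 'C(L, k.+1)%:R = (L - k)%:R * 'C(L, k)%:R :> F.
    by rewrite -!natrM mul_bin_left.
  rewrite /weight e.
  have dN : (L - k)%:R != 0 :> F by rewrite pnatr_eq0 subn_eq0 -ltnNge.
  by field; rewrite cN dN.
have [k0|k0] := posnP k.
  rewrite k0 in kL next *; rewrite !mul0r mulr0 addr0 sub0r /=.
  by rewrite next // bin0 divr1 expr1.
rewrite mulr_weight //.
have [kE|kN] := eqVneq k L.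
  rewrite kE subnn mul0r mulr0 subr0 binn divr1 exprS mulrA mulr_growth.
  by rewrite mulrDl mul1r.
have ltkL : (k < L)%N by rewrite ltn_neqAle kN.
rewrite next // exprS -{2}[growth F L ^+ k / _]mul1r -mulrDl -mulr_growth.
by rewrite !mulrA subrr.
Qed.

(** Reindexing the pairs (J, i) by J - i collects the coefficient of each G(J); by [weight_level] it
    is zero unless J is empty or full. *)
Lemma weight_identity (G : {set 'I_L} -> F) :
  \sum_(J : {set 'I_L}) weight F L #|J| *
      (L%:R * (\sum_(i in J) (G J - G (J :\ i))) + #|J|%:R * G J) =
  L%:R * growth F L ^+ L.+1 * G setT - L%:R * growth F L * G set0.
Proof.
have shift : \sum_(J : {set 'I_L}) weight F L #|J| * (\sum_(i in J) G (J :\ i)) =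
             \sum_(J : {set 'I_L}) (L - #|J|)%:R * weight F L #|J|.+1 * G J.
  under eq_bigr do rewrite big_distrr /=.
  rewrite (exchange_big_dep predT) //=.
  transitivity (\sum_i \sum_(J : {set 'I_L} | i \notin J) weight F L #|J|.+1 * G J).
    apply: eq_bigr => i _.
    rewrite (reindex_onto (fun J => i |: J) (fun J => J :\ i)) /=; last first.
      by move=> J iJ; rewrite setD1K.
    apply: eq_big => J.
      rewrite setU11 /=; apply/eqP/idP => [<-|iJ]; first by rewrite !inE eqxx.
      exact: setU1K.
    case/andP=> _ /eqP e; have iJ : i \notin J by rewrite -e !inE eqxx.
    by rewrite e cardsU1 iJ.
  rewrite (exchange_big_dep predT) //=; apply: eq_bigr => J _.
  rewrite sumr_const -mulrA mulr_natl; congr (_ *+ _).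
  have := cardC (mem J); rewrite card_ord => e; rewrite -[X in (X - _)%N]e addKn.
  by apply: eq_card => i; rewrite !inE.
rewrite (eq_bigr (fun J : {set 'I_L} => (if #|J| == 0%N then - (L%:R * growth F L)
  else if #|J| == L then L%:R * growth F L ^+ L.+1 else 0) * G J +
    (L%:R * ((L - #|J|)%:R * weight F L #|J|.+1 * G J)
     - L%:R * (weight F L #|J| * (\sum_(i in J) G (J :\ i)))))); last first.
  move=> J _; rewrite -weight_level; last by have := max_card (mem J); rewrite card_ord.
  rewrite sumrB sumr_const -mulr_natl; ring.
rewrite big_split /= sumrB -!mulr_sumr shift subrr addr0.
rewrite (bigD1 set0) //= (bigD1 setT) /=; last first.
  by rewrite -cards_eq0 cardsT card_ord -lt0n.
rewrite cards0 cardsT card_ord eqxx [X in (if X then _ else _) * G setT]eqn0Ngt L_gt0 /= eqxx big1 ?addr0; last first.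
  move=> J /andP[J0 JT]; rewrite cards_eq0 (negPf J0).
  rewrite (_ : (#|J| == L) = false) ?mul0r //.
  by apply: contraNF JT => /eqP e; rewrite eqEcard subsetT cardsT card_ord e leqnn.
by rewrite addrC mulNr.
Qed.

(** The total coefficient of g(O) in the averaged inequality, obtained from [weight_identity] with G
    constant. *)
Lemma weight_sum :
  \sum_(J : {set 'I_L}) weight F L #|J| * #|J|%:R =
  L%:R * growth F L ^+ L.+1 - L%:R * growth F L.
Proof.
rewrite -[X in X - _]mulr1 -[X in _ - X]mulr1 -(weight_identity (fun=> 1)).
apply: eq_bigr => J _; rewrite big1 ?mulr0 ?add0r ?mulr1 // => i _.
by rewrite subrr.
Qed.

End Weights.

(** * Local optima of the potential *)

Lemma setD1_id (X : finType) (A : {set X}) x : x \notin A -> A :\ x = A.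
Proof. by move=> xA; apply/setDidPl; rewrite disjoint_sym disjoints1. Qed.

Lemma set_ind1 (X : finType) (P : {set X} -> Prop) :
  P set0 -> (forall x (S : {set X}), x \notin S -> P S -> P (x |: S)) -> forall S, P S.
Proof.
move=> P0 PU S; move: {2}#|S| (erefl #|S|) => k.
elim: k S => [|k IH] S cS; first by rewrite (cards0_eq cS).
have [x xS] : exists x, x \in S by apply/set0Pn; rewrite -cards_eq0 cS.
rewrite -(setD1K xS); apply: PU; first by rewrite setD11.
by apply: IH; move: cS; rewrite (cardsD1 x) xS add1n => -[].
Qed.

(** * Marginal inequalities for submodular functions *)

Section Submodular.
Variables (R : realType) (X : finType) (g : {set X} -> R).
Hypotheses (g_mono : nondecreasing_set g) (g_sub : submodular g).
Implicit Types S O U : {set X}.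

Lemma sum_gain S O : g (S :|: O) - g S <= \sum_(v in O) (g (v |: S) - g S).
Proof.
elim/set_ind1: O => [|x O xO IH]; first by rewrite setU0 subrr big_set0.
rewrite big_setU1 //=.
have := g_sub (S :|: O) (x |: S).
have -> : (S :|: O) :|: (x |: S) = S :|: (x |: O).
  by apply/setP => z; rewrite !inE; case: (z == x); case: (z \in S); case: (z \in O).
have : g S <= g ((S :|: O) :&: (x |: S)).
  by apply: g_mono; rewrite subsetI subsetUl subsetUr.
by move: IH; lra.
Qed.

Lemma sum_loss S U : \sum_(u in U) (g S - g (S :\ u)) <= g S - g (S :\: U).
Proof.
elim/set_ind1: U => [|x U xU IH]; first by rewrite setD0 subrr big_set0.
rewrite big_setU1 //=.
have := g_sub (S :\: U) (S :\ x).
have -> : (S :\: U) :|: (S :\ x) = S.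
  rewrite -setDIr; apply/setDidPl; rewrite -setI_eq0; apply/eqP/setP => z.
  by rewrite !inE; case: eqVneq => [->|]; rewrite ?(negPf xU) ?andbF.
have -> : (S :\: U) :&: (S :\ x) = S :\: (x |: U).
  by rewrite -setDUr setUC.
by move: IH; lra.
Qed.

End Submodular.

Lemma sum_setUI (R : realType) (X : finType) (F : X -> R) (A B : {set X}) :
  \sum_(x in A :&: B) F x + \sum_(x in A :|: B) F x =
  \sum_(x in A) F x + \sum_(x in B) F x.
Proof.
rewrite !(big_mkcond (fun x => x \in _)) /= -!big_split /=; apply: eq_bigr => x _.
by rewrite !inE; case: (x \in A); case: (x \in B); rewrite ?addr0 ?add0r.
Qed.

Definition top_marginal (R : realType) (X : finType) (f : {set X} -> R) (x : X) : R :=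
  f setT - f (~: [set x]).

Definition residual (R : realType) (X : finType) (f : {set X} -> R) (S : {set X}) : R :=
  f S - \sum_(x in S) top_marginal f x.

Definition labelled (X : finType) (L : nat) (lab : {ffun X -> option 'I_L})
    (J : {set 'I_L}) : {set X} :=
  [set x | if lab x is Some j then j \in J else false].

(** Testing v before u makes the case u = v meaningful: it inserts v, or changes its label if v is
    already present. *)
Definition relabel (X : finType) (L : nat) (lab : {ffun X -> option 'I_L})
    (u v : X) (j : 'I_L) : {ffun X -> option 'I_L} :=
  [ffun x => if x == v then Some j else if x == u then None else lab x].

(** The coefficient of the linear part equals, up to the factor L from summing over labels, the one
    that [weight_identity] leaves on g(A), so that g(A) + l(A) = f(A) appears in the end. *)
Definition potential (R : realType) (X : finType) (L : nat) (f : {set X} -> R)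
    (lab : {ffun X -> option 'I_L}) : R :=
  \sum_(J : {set 'I_L}) weight R L #|J| * residual f (labelled lab J)
  + growth R L ^+ L.+1 * \sum_(x in labelled lab setT) top_marginal f x.

Section Residual.
Variables (R : realType) (X : finType) (f : {set X} -> R).
Hypotheses (f_ge0 : nonneg f) (f_mono : nondecreasing_set f) (f_sub : submodular f).
Implicit Types S T O A : {set X}.

Lemma top_marginal_ge0 x : 0 <= top_marginal f x.
Proof. by rewrite subr_ge0 f_mono // subsetT. Qed.

Lemma top_marginal_le x S : x \notin S -> top_marginal f x <= f (x |: S) - f S.
Proof.
move=> xS; have := f_sub (x |: S) (~: [set x]).
have -> : (x |: S) :&: ~: [set x] = S.
  apply/setP => z; rewrite !inE; case: eqVneq => [->|] /=; last by rewrite andbT.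
  by rewrite (negPf xS).
have -> : (x |: S) :|: ~: [set x] = setT.
  by apply/setP => z; rewrite !inE; case: (z == x); rewrite ?orbT.
by rewrite /top_marginal; lra.
Qed.

(** By diminishing returns, every marginal of f at x is at least the last one, which is what is
    subtracted. *)
Lemma residual_mono : nondecreasing_set (residual f).
Proof.
move=> S T sST; rewrite -(setID T S) (setIidPr sST).
have : (T :\: S) :&: S = set0 by rewrite setDE setIAC -setIA setICr setI0.
elim/set_ind1: (T :\: S) => [_|x D xD IH]; first by rewrite setU0.
rewrite setIUl => /eqP; rewrite setU_eq0 => /andP[/eqP xS /eqP /IH /le_trans]; apply.
have {}xS : x \notin S.
  by apply/negP => xS'; move/setP/(_ x): xS; rewrite !inE eqxx xS'.
rewrite setUCA; have xSD : x \notin S :|: D by rewrite inE negb_or xS.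
by rewrite /residual big_setU1 //=; have := top_marginal_le xSD; lra.
Qed.

Lemma residual_sub : submodular (residual f).
Proof.
move=> A B; rewrite /residual; have := f_sub A B.
by have := sum_setUI (top_marginal f) A B; lra.
Qed.

Lemma residual0 : residual f set0 = f set0.
Proof. by rewrite /residual big_set0 subr0. Qed.

Lemma residual_ge0 S : 0 <= residual f S.
Proof. by apply: le_trans (residual_mono (sub0set S)); rewrite residual0. Qed.

Lemma sum_top_marginal_le S : \sum_(x in S) top_marginal f x <= f S.
Proof. by rewrite -subr_ge0 residual_ge0. Qed.

Lemma residual_le S : residual f S <= f S.
Proof. by rewrite gerBl sumr_ge0 // => x _; apply: top_marginal_ge0. Qed.

Section Local.
Variable (L : nat).
Hypothesis L_gt0 : (0 < L)%N.
Implicit Types (lab : {ffun X -> option 'I_L}) (J : {set 'I_L}).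

Lemma labelled_relabel lab u v j J :
  labelled (relabel lab u v j) J =
  if j \in J then v |: (labelled lab J :\ u) else labelled lab J :\ u :\ v.
Proof.
apply/setP => x; case: (boolP (j \in J)) => [jJ|/negPf jJ]; rewrite !inE ffunE.
  by case: (x == v); rewrite ?jJ //; case: (x == u).
by case: (x == v); rewrite ?jJ //; case: (x == u).
Qed.

Lemma labelled_set0 lab : labelled lab set0 = set0.
Proof. by apply/setP => x; rewrite !inE; case: (lab x) => // j; rewrite inE. Qed.

Lemma labelled_subT lab J : labelled lab J \subset labelled lab setT.
Proof. by apply/subsetP => x; rewrite !inE; case: (lab x) => // j; rewrite inE. Qed.

Lemma labelledD1 lab J i :
  labelled lab (J :\ i) = labelled lab J :\: labelled lab [set i].
Proof.
by apply/setP => x; rewrite !inE; case: (lab x) => // j; rewrite !inE.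
Qed.

Lemma sum_labelled lab J (F : X -> R) :
  \sum_(x in labelled lab J) F x = \sum_(i in J) \sum_(x in labelled lab [set i]) F x.
Proof.
rewrite (exchange_big_dep (fun x => x \in labelled lab J)) /=; last first.
  by move=> i x iJ; rewrite !inE; case: (lab x) => // j; rewrite inE => /eqP->.
apply: eq_bigr => x xJ.
have [j E jJ] : exists2 j, lab x = Some j & j \in J.
  by move: xJ; rewrite inE; case: (lab x) => // j jJ; exists j.
rewrite (bigD1 j) /=; last by rewrite jJ inE E set11.
rewrite big1 ?addr0 // => i /andP[/andP[_ +] +]; rewrite inE E inE => /eqP ->.
by rewrite eqxx.
Qed.

(** Separates insertion from deletion. When j is in J, submodularity on v + (S - u) and S gives g(v
    + (S - u)) - g(S) >= (g(v + S) - g(S)) - (g(S) - g(S - u)); the other J only lose u. *)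
Lemma potential_relabel lab u v j :
  (u == v) || (v \notin labelled lab setT) ->
  \sum_(J : {set 'I_L}) weight R L #|J| *
     ((j \in J)%:R * (residual f (v |: labelled lab J) - residual f (labelled lab J))
      - (residual f (labelled lab J) - residual f (labelled lab J :\ u)))
  + growth R L ^+ L.+1 *
     (top_marginal f v - (u \in labelled lab setT)%:R * top_marginal f u)
  <= potential f (relabel lab u v j) - potential f lab.
Proof.
move=> uv; rewrite /potential opprD addrACA -sumrB -mulrBr; apply: lerD.
  apply: ler_sum => J _; rewrite -mulrBr; apply: ler_wpM2l; first exact: weight_ge0.
  rewrite labelled_relabel; set S := labelled lab J.
  case: ifP => jJ.
    rewrite mul1r; have := residual_sub (v |: (S :\ u)) S.
    have -> : (v |: (S :\ u)) :|: S = v |: S.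
      by rewrite -setUA (setUidPr (subsetDl S [set u])).
    have : residual f (S :\ u) <= residual f ((v |: (S :\ u)) :&: S).
      by apply: residual_mono; rewrite subsetI subsetDl subsetUr.
    by lra.
  have -> : S :\ u :\ v = S :\ u.
    apply: setD1_id; rewrite inE.
    case/orP: uv => [/eqP->|vA]; rewrite !inE ?eqxx //.
    by apply: contra vA => /andP[_ vS]; apply: (subsetP (labelled_subT lab J)); rewrite inE.
  by rewrite mul0r; lra.
apply: ler_wpM2l; first by rewrite exprn_ge0 // ltW // growth_gt0.
rewrite labelled_relabel in_setT; set A := labelled lab setT.
have -> : \sum_(x in A) top_marginal f x =
    (u \in A)%:R * top_marginal f u + \sum_(x in A :\ u) top_marginal f x.
  case: (boolP (u \in A)) => uA; first by rewrite (big_setD1 u) //= mul1r.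
  by rewrite mul0r add0r setD1_id.
rewrite big_setU1 /=; first by lra.
by rewrite !inE; case/orP: uv => [/eqP->|/negPf]; rewrite ?eqxx // inE => ->; rewrite andbF.
Qed.

Lemma local_optimum_bound (I : {set {set X}}) lab (tau : R) O :
  matroid I -> labelled lab setT \in I -> O \in I ->
  (forall u v j, labelled (relabel lab u v j) setT \in I ->
     potential f (relabel lab u v j) <= potential f lab + tau) ->
  0 <= tau ->
  f O - (growth R L ^+ L)^-1 * (f O - f set0 - \sum_(x in O) top_marginal f x)
    - #|O|%:R * tau <= f (labelled lab setT).
Proof.
move=> matI AI OI opt tau0; set A := labelled lab setT.
have [h [injh hA hI]] := indep_matching matI AI OI.
set q := growth R L; set l := top_marginal f; set g := residual f.
pose S J := labelled lab J.
have q0 : 0 < q by apply: growth_gt0.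
have LR : (0 : R) < L%:R by rewrite ltr0n.
have move_le v j : v \in O ->
    \sum_(J : {set 'I_L}) weight R L #|J| *
     ((j \in J)%:R * (g (v |: S J) - g (S J)) - (g (S J) - g (S J :\ h v)))
     + q ^+ L.+1 * (l v - (h v \in A)%:R * l (h v)) <= tau.
  move=> vO; apply: (@le_trans _ _ (potential f (relabel lab (h v) v j) - potential f lab)).
    apply: potential_relabel.
    by case/orP: (hA v vO) => [->//|/andP[_ ->]]; rewrite orbT.
  rewrite lerBlDl; apply: opt; rewrite labelled_relabel in_setT; exact: hI.
have total : \sum_(v in O) \sum_(j : 'I_L)
    (\sum_(J : {set 'I_L}) weight R L #|J| *
     ((j \in J)%:R * (g (v |: S J) - g (S J)) - (g (S J) - g (S J :\ h v)))
     + q ^+ L.+1 * (l v - (h v \in A)%:R * l (h v))) <= #|O|%:R * (L%:R * tau).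
  apply: (@le_trans _ _ (\sum_(v in O) \sum_(j : 'I_L) tau)).
    by apply: ler_sum => v vO; apply: ler_sum => j _; apply: move_le.
  by rewrite !sumr_const card_ord -(mulr_natl tau) -[leLHS]mulr_natl.
(* Since h is injective on O, the partners are charged at most once each. *)
have sum_h (F : X -> R) : (forall x, 0 <= F x) ->
    \sum_(v in O) F (h v) <= \sum_x F x.
  move=> F0; rewrite -(big_imset (fun x => F x)) //= [leRHS](bigID (mem (h @: O))) /=.
  by rewrite lerDl sumr_ge0.
have gain J : g O - g (S J) <= \sum_(v in O) (g (v |: S J) - g (S J)).
  apply: le_trans (sum_gain residual_mono residual_sub _ _).
  by rewrite lerB // residual_mono // subsetUr.
(* Deletions are grouped by label: removing the elements of class i one at a time costs at most
   removing the whole class, which turns S_J into S_(J - i). *)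
have loss J : \sum_(v in O) (g (S J) - g (S J :\ h v)) <=
    \sum_(i in J) (g (S J) - g (S (J :\ i))).
  pose b u := g (S J) - g (S J :\ u).
  have b0 u : 0 <= b u by rewrite subr_ge0 residual_mono // subsetDl.
  apply: (le_trans (sum_h b b0)).
  rewrite (bigID (mem (S J))) /= [X in _ + X]big1 ?addr0; last first.
    by move=> u uS; rewrite /b setD1_id ?subrr.
  rewrite sum_labelled; apply: ler_sum => i _; rewrite /S labelledD1.
  exact: (sum_loss residual_sub).
have linear : \sum_(x in O) l x - \sum_(x in A) l x <=
    \sum_(v in O) (l v - (h v \in A)%:R * l (h v)).
  rewrite [leRHS]sumrB; apply: lerB => //.
  apply: (le_trans (sum_h (fun x => (x \in A)%:R * l x) _)) => [x|].
    by rewrite mulr_ge0 ?ler0n ?top_marginal_ge0.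
  rewrite [leRHS]big_mkcond /=; apply: ler_sum => x _.
  by case: ifP; rewrite ?mul1r ?mul0r.
have W := @weight_sum R L L_gt0.
have ID := @weight_identity R L L_gt0 (fun J => g (S J)).
have cardJ (J : {set 'I_L}) : \sum_(j : 'I_L) (j \in J)%:R = #|J|%:R :> R.
  rewrite -sum1_card natr_sum [RHS]big_mkcond; apply: eq_bigr => j _.
  by case: (j \in J).
have swap (a b : {set 'I_L} -> R) (z : R) :
    \sum_(j : 'I_L) (\sum_(J : {set 'I_L}) weight R L #|J| * ((j \in J)%:R * a J - b J) + z)
    = \sum_(J : {set 'I_L}) weight R L #|J| * (#|J|%:R * a J - L%:R * b J) + L%:R * z.
  rewrite big_split /= sumr_const card_ord -(mulr_natl z) exchange_big; congr (_ + _).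
  apply: eq_bigr => J _; rewrite -mulr_sumr sumrB -mulr_suml cardJ sumr_const card_ord.
  by rewrite -(mulr_natl (b J)).
have key : \sum_(J : {set 'I_L}) weight R L #|J| *
     (#|J|%:R * (g O - g (S J)) - L%:R * (\sum_(i in J) (g (S J) - g (S (J :\ i)))))
     + L%:R * (q ^+ L.+1 * (\sum_(x in O) l x - \sum_(x in A) l x))
     <= #|O|%:R * (L%:R * tau).
  apply: le_trans total.
  rewrite (eq_bigr _ (fun v _ => swap (fun J => g (v |: S J) - g (S J))
    (fun J => g (S J) - g (S J :\ h v)) (q ^+ L.+1 * (l v - (h v \in A)%:R * l (h v))))).
  rewrite [leRHS]big_split /= [X in _ <= X + _]exchange_big /=; apply: lerD.
    apply: ler_sum => J _; rewrite -mulr_sumr; apply: ler_wpM2l; first exact: weight_ge0.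
    by rewrite [leRHS]sumrB -!mulr_sumr lerB // ler_wpM2l ?ler0n.
  rewrite -!mulr_sumr; apply: ler_wpM2l; first exact: ltW.
  by apply: ler_wpM2l linear; apply: exprn_ge0; apply: ltW.
have {}ID : \sum_(J : {set 'I_L}) weight R L #|J| *
     (#|J|%:R * (g O - g (S J)) - L%:R * (\sum_(i in J) (g (S J) - g (S (J :\ i)))))
  = (L%:R * q ^+ L.+1 - L%:R * q) * g O -
    (L%:R * q ^+ L.+1 * g A - L%:R * q * f set0).
  rewrite -W mulr_suml -residual0 -[in RHS](labelled_set0 lab) -ID -sumrB.
  apply: eq_bigr => J _; ring.
rewrite ID in key.
have gO : g O = f O - \sum_(x in O) l x by [].
have gA : g A = f A - \sum_(x in A) l x by [].
have qL : 0 < q ^+ L by rewrite exprn_gt0.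
have qL1 : 1 <= q ^+ L.+1 by rewrite exprn_ege1 // growth_ge1.
rewrite gO gA in key.
set Q := q ^+ L.+1 in key qL1 *.
have Qz : Q * (q ^+ L)^-1 = q by rewrite /Q exprS mulfK // gt_eqF.
(* The final division by Q >= 1 can only shrink the error term. *)
have err : #|O|%:R * tau <= Q * (#|O|%:R * tau).
  by rewrite ler_peMl // mulr_ge0 ?ler0n.
have {}key : Q * f O - q * (f O - f set0 - \sum_(x in O) l x) - #|O|%:R * tau
    <= Q * f A.
  rewrite -(ler_pM2l LR); move: key; set lO := \sum_(x in O) _; set lA := \sum_(x in A) _.
  by lra.
rewrite -(@ler_pM2l _ Q); last exact: lt_le_trans ltr01 qL1.
move: key Qz; set zi := (q ^+ L)^-1; set D := f O - f set0 - _ => key Qz.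
have -> : Q * (f O - zi * D - #|O|%:R * tau) =
    Q * f O - q * D - Q * (#|O|%:R * tau) by rewrite -[in RHS]Qz; ring.
by lra.
Qed.

End Local.
End Residual.

(** * The local search *)

Definition try_move (R : realType) (X : finType) (L : nat) (f : {set X} -> R)
    (I : {set {set X}}) (tau : R) (u v : X) (lab : {ffun X -> option 'I_L})
    (j : 'I_L) : {ffun X -> option 'I_L} :=
  let lab' := relabel lab u v j in
  if (labelled lab' setT \in I) && ~~ (potential f lab' <= potential f lab + tau)
  then lab' else lab.

Definition search_pass (R : realType) (X : finType) (L : nat) (f : {set X} -> R)
    (I : {set {set X}}) (tau : R) (lab : {ffun X -> option 'I_L}) :=
  foldl (fun lab u => foldl (fun lab v =>
    foldl (try_move f I tau u v) lab (enum 'I_L)) lab (enum X)) lab (enum X).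

Section Search.
Variables (R : realType) (X : finType) (L : nat) (f : {set X} -> R).
Variables (I : {set {set X}}) (tau : R).
Implicit Types lab : {ffun X -> option 'I_L}.

(** This dichotomy passes through nested folds: if nothing moved, all tests were made on the same
    labelling. The strict gain stays informative even when tau = 0. *)
Definition progress (P : {ffun X -> option 'I_L} -> Prop) lab lab' : Prop :=
  (lab' = lab /\ P lab) \/ potential f lab + tau < potential f lab'.

Lemma foldl_progress (T : eqType) (s : seq T)
    (F : {ffun X -> option 'I_L} -> T -> {ffun X -> option 'I_L})
    (P : T -> {ffun X -> option 'I_L} -> Prop) lab :
  0 <= tau -> (forall lab a, progress (P a) lab (F lab a)) ->
  progress (fun lab => forall a, a \in s -> P a lab) lab (foldl F lab s).
Proof.
move=> tau0 FP; elim: s lab => [|a s IH] lab /=; first by left; split.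
have [[-> Pa]|lt1] := FP lab a.
  have [[-> Ps]|lt2] := IH lab; last by right.
  by left; split=> // b; rewrite inE => /orP[/eqP->|/Ps].
by right; have [[-> _]|lt2] := IH (F lab a); lra.
Qed.

Definition local_optimum lab : Prop := forall u v j,
  labelled (relabel lab u v j) setT \in I ->
  potential f (relabel lab u v j) <= potential f lab + tau.

Lemma search_pass_progress lab : 0 <= tau ->
  progress local_optimum lab (search_pass f I tau lab).
Proof.
move=> tau0; pose P u v (j : 'I_L) lab := labelled (relabel lab u v j) setT \in I ->
  potential f (relabel lab u v j) <= potential f lab + tau : Prop.
suff : progress (fun lab => forall u, u \in enum X -> forall v, v \in enum X ->
    forall j, j \in enum 'I_L -> P u v j lab) lab (search_pass f I tau lab).
  case=> [[e H]|]; last by right.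
  by left; split=> // u v j; apply: H; rewrite mem_enum.
apply: foldl_progress => // {}lab u; apply: foldl_progress => // {}lab v.
apply: foldl_progress => // {}lab j; rewrite /try_move.
case: ifP => [/andP[_]|]; first by rewrite -ltNge; right.
by move=> /negP H; left; split=> // AI; apply: contra_notT H => ->; rewrite AI.
Qed.

Lemma search_pass_indep lab : labelled lab setT \in I ->
  labelled (search_pass f I tau lab) setT \in I.
Proof.
have inv (T : Type) (F : {ffun X -> option 'I_L} -> T -> {ffun X -> option 'I_L}) s lab' :
    (forall lab a, labelled lab setT \in I -> labelled (F lab a) setT \in I) ->
    labelled lab' setT \in I -> labelled (foldl F lab' s) setT \in I.
  by move=> FI; elim: s lab' => //= a s IH lab' /(FI _ a) /IH.
apply: (inv) => {}lab u; apply: (inv) => {}lab v; apply: (inv) => {}lab j labI.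
by rewrite /try_move; case: ifP => // /andP[].
Qed.

(** Surplus passes are harmless, so the program needs no convergence test. *)
Lemma search_pass_stable lab : local_optimum lab -> search_pass f I tau lab = lab.
Proof.
have fix_foldl (T : Type) (F : {ffun X -> option 'I_L} -> T -> {ffun X -> option 'I_L}) s :
    (forall a, F lab a = lab) -> foldl F lab s = lab.
  by move=> FE; elim: s => //= a s; rewrite FE.
move=> opt; apply: (fix_foldl) => u; apply: (fix_foldl) => v; apply: (fix_foldl) => j.
by rewrite /try_move; case: ifP => // /andP[/opt ->].
Qed.

Lemma iter_search_pass N lab : 0 <= tau -> (0 < N)%N ->
  local_optimum (iter N (search_pass f I tau) lab) \/
  potential f lab + N%:R * tau < potential f (iter N (search_pass f I tau) lab).
Proof.
move=> tau0; case: N => // N _; elim: N => [|N IH].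
  by have [[e loc]|] := search_pass_progress lab tau0; rewrite ?mul1r; [left|right] => //=; rewrite e.
rewrite iterS; set lab' := iter _ _ _ in IH *.
have [loc|lt2] := IH; first by left; rewrite search_pass_stable.
have [[e loc]|lt1] := search_pass_progress lab' tau0; first by left; rewrite e.
by right; rewrite -natr1 mulrDl mul1r; lra.
Qed.

End Search.

(** * Number of passes and approximation ratio *)

Definition singleton_mass (R : realType) (X : finType) (f : {set X} -> R)
    (I : {set {set X}}) : R :=
  f set0 + \sum_(x | [set x] \in I) f [set x].

Definition threshold (R : realType) (X : finType) (f : {set X} -> R)
    (I : {set {set X}}) (L : nat) : R :=
  L%:R^-1 * singleton_mass f I / (#|X|%:R * #|X|%:R).

Definition final_labelling (R : realType) (X : finType) (L : nat) (f : {set X} -> R)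
    (I : {set {set X}}) (B : nat) : {ffun X -> option 'I_L} :=
  iter (#|X| * (#|X| * B)) (search_pass f I (threshold f I L)) [ffun=> None].

Definition potential_factor (R : realType) (L : nat) : R :=
  \sum_(J : {set 'I_L}) weight R L #|J| + growth R L ^+ L.+1.

Section Guarantee.
Variables (R : realType) (X : finType) (L : nat) (f : {set X} -> R).
Variables (I : {set {set X}}).
Hypothesis L_gt0 : (0 < L)%N.
Hypotheses (f_ge0 : nonneg f) (f_mono : nondecreasing_set f) (f_sub : submodular f).
Hypothesis matI : matroid I.
Implicit Types lab : {ffun X -> option 'I_L}.

Lemma le_singleton_mass S : S \in I -> f S <= singleton_mass f I.
Proof.
move=> SI; have := sum_gain f_mono f_sub set0 S; rewrite set0U.
under eq_bigr do rewrite setU0.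
rewrite sumrB /singleton_mass => le1.
have le2 : \sum_(x in S) f [set x] <= \sum_(x | [set x] \in I) f [set x].
  rewrite [leRHS](bigID (mem S)) /= [X in _ <= X + _](eq_bigl (mem S)) => [|x].
    by rewrite lerDl sumr_ge0.
  apply: andb_idl => xS; apply: (indep_sub matI) SI; by rewrite sub1set.
have : 0 <= \sum_(x in S) f set0 by rewrite sumr_ge0.
by lra.
Qed.

Lemma singleton_mass_ge0 : 0 <= singleton_mass f I.
Proof. by rewrite addr_ge0 ?sumr_ge0. Qed.

Lemma singleton_mass_le (m : R) :
  (forall S, S \in I -> f S <= m) -> singleton_mass f I <= #|X|.+1%:R * m.
Proof.
move=> fm; have [I0 _ _] := matI.
have m0 : 0 <= m by apply: le_trans (fm _ I0).
rewrite -natr1 mulrDl mul1r addrC lerD ?fm //.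
apply: (@le_trans _ _ (\sum_(x : X) m)); last by rewrite sumr_const -(mulr_natl m).
rewrite big_mkcond; apply: ler_sum => x _.
by case: ifP => // /fm.
Qed.

Lemma threshold_ge0 : 0 <= threshold f I L.
Proof.
by rewrite !mulr_ge0 ?invr_ge0 ?mulr_ge0 ?ler0n ?singleton_mass_ge0.
Qed.

Lemma potential_ge0 lab : 0 <= potential f lab.
Proof.
rewrite addr_ge0 ?sumr_ge0 // => [J _|].
  by rewrite mulr_ge0 ?weight_ge0 ?residual_ge0.
rewrite mulr_ge0 ?exprn_ge0 ?sumr_ge0 // => [|x _]; last exact: top_marginal_ge0.
by rewrite ltW ?growth_gt0.
Qed.

Lemma potential_le lab : labelled lab setT \in I ->
  potential f lab <= potential_factor R L * singleton_mass f I.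
Proof.
move=> labI; rewrite /potential_factor mulrDl mulr_suml; apply: lerD.
  apply: ler_sum => J _; apply: ler_wpM2l; first exact: weight_ge0.
  apply: le_trans (residual_le f_mono _) _; apply: le_singleton_mass.
  exact: (indep_sub matI) (labelled_subT lab J) labI.
apply: ler_wpM2l; first by rewrite exprn_ge0 // ltW ?growth_gt0.
by apply: le_trans (le_singleton_mass labI); apply: sum_top_marginal_le.
Qed.

Lemma final_labelling_indep B : labelled (final_labelling L f I B) setT \in I.
Proof.
rewrite /final_labelling; elim: (_ * _)%N => [|k IH] /=; last exact: search_pass_indep.
have -> : labelled ([ffun=> None] : {ffun X -> option 'I_L}) setT = set0.
  by apply/setP => x; rewrite !inE ffunE.
by case: matI.
Qed.

(** Otherwise the |X|^2 B passes would gain more than (B / L) M, which is at least the upper bound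
    of [potential_le], from a nonnegative start. *)
Lemma final_labelling_opt B : L%:R * potential_factor R L <= B%:R ->
  local_optimum f I (threshold f I L) (final_labelling L f I B).
Proof.
move=> hB; suff loc : (0 < #|X|)%N ->
    local_optimum f I (threshold f I L) (final_labelling L f I B).
  by move=> u v j; apply: loc; apply/card_gt0P; exists u.
move=> n0.
have LR : 0 < L%:R :> R by rewrite ltr0n.
have nR : 0 < #|X|%:R :> R by rewrite ltr0n.
have C0 : 0 < potential_factor R L.
  rewrite ltr_wpDl ?sumr_ge0 // => [J _|]; first exact: weight_ge0.
  by rewrite exprn_gt0 ?growth_gt0.
have B0 : (0 < B)%N by rewrite -(ltr0n R); apply: lt_le_trans hB; rewrite mulr_gt0.
have N0 : (0 < #|X| * (#|X| * B))%N by rewrite !muln_gt0 n0 B0.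
have [//|] := @iter_search_pass R X L f I _ _ [ffun=> None] threshold_ge0 N0.
rewrite -/(final_labelling L f I B) => lt1.
have le1 := potential_le (final_labelling_indep B).
have ge0 := @potential_ge0 [ffun=> None].
have e : (#|X| * (#|X| * B))%:R * threshold f I L =
    L%:R^-1 * B%:R * singleton_mass f I.
  by rewrite !natrM /threshold; field; rewrite !gt_eqF.
have : potential_factor R L * singleton_mass f I <=
    L%:R^-1 * B%:R * singleton_mass f I.
  apply: ler_wpM2r; first exact: singleton_mass_ge0.
  by rewrite -(ler_pM2l LR) mulrA divff ?gt_eqF // mul1r.
by move: lt1 le1 ge0; rewrite e; lra.
Qed.

(** Curvature gives l(x) >= (1 - c) f_{}(x) for each x, and the f_{}(x) with x in O sum to at least
    f(O) - f({}). *)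
Lemma curvature_le (c : R) O : 0 <= c -> curvature f <= c ->
  f O - f set0 - \sum_(x in O) top_marginal f x <= c * f O.
Proof.
move=> c0 fc.
have marg x : (1 - c) * marginal f set0 x <= top_marginal f x.
  have d0 : 0 <= marginal f set0 x by rewrite subr_ge0 f_mono // subsetUr.
  have t0 := top_marginal_ge0 f_mono x.
  have : (marginal f set0 x - marginal f (~: [set x]) x) / marginal f set0 x <= c.
    apply: le_trans fc; exact: le_bigmax.
  rewrite /marginal (_ : x |: ~: [set x] = setT) ?setUCr // -/(top_marginal f x).
  rewrite -/(marginal f set0 x).
  move: d0; rewrite le_eqVlt => /orP[/eqP<- _|d0]; first by rewrite mulr0.
  by rewrite ler_pdivrMr // => h; rewrite mulrBl mul1r; lra.
have := sum_gain f_mono f_sub set0 O; rewrite set0U => le1.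
have le2 : (1 - c) * \sum_(x in O) (f (x |: set0) - f set0) <=
    \sum_(x in O) top_marginal f x.
  by rewrite mulr_sumr; apply: ler_sum => x _; apply: marg.
have [c1|c1] := leP c 1.
  have : (1 - c) * (f O - f set0) <= (1 - c) * \sum_(x in O) (f (x |: set0) - f set0).
    by apply: ler_wpM2l => //; rewrite subr_ge0.
  by have := mulr_ge0 c0 (f_ge0 set0); lra.
have : 0 <= \sum_(x in O) top_marginal f x.
  by apply: sumr_ge0 => x _; apply: top_marginal_ge0.
have := f_ge0 set0.
have : f O <= c * f O by rewrite ler_peMl // ltW.
by lra.
Qed.

(** From exp(-1/(L+1)) >= 1 - 1/(L+1) = 1/q follows e <= q^(L+1), hence q^(-L) <= q / e = 1/e + 1/(L
    e). *)
Lemma inv_growth_le : (growth R L ^+ L)^-1 <= (expR 1)^-1 + L%:R^-1.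
Proof.
have LR : 0 < L%:R :> R by rewrite ltr0n.
have q0 : 0 < growth R L by apply: growth_gt0.
have e0 : 0 < expR 1 :> R by apply: expR_gt0.
have step : expR (L.+1%:R^-1) <= growth R L.
  have := expR_ge1Dx (- L.+1%:R^-1 : R); rewrite expRN => h.
  have y0 : 0 < expR (L.+1%:R^-1) :> R by apply: expR_gt0.
  have p0 : 0 < L.+1%:R :> R by rewrite ltr0n.
  have e1 : 1 - L.+1%:R^-1 = (growth R L)^-1.
    rewrite /growth -natr1; field; rewrite !gt_eqF //; lra.
  by move: h; rewrite e1 lef_pV2.
have e_le : expR 1 <= growth R L ^+ L.+1.
  have -> : expR 1 = expR (L.+1%:R^-1) ^+ L.+1 :> R.
    by rewrite -expRM_natl divff // pnatr_eq0.
  by rewrite lerXn2r // nnegrE ltW // expR_gt0.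
have -> : (growth R L ^+ L)^-1 = growth R L * (growth R L ^+ L.+1)^-1.
  by rewrite exprS invfM mulrA divff ?mul1r // gt_eqF.
apply: (@le_trans _ _ (growth R L * (expR 1)^-1)).
  by apply: ler_wpM2l; [exact: ltW|rewrite lef_pV2 ?posrE ?exprn_gt0].
rewrite /growth mulrDl mul1r lerD2l ler_piMr ?invr_ge0 ?ler0n //.
by rewrite invf_le1 // -[leLHS]expR0 ler_expR.
Qed.

(** Of the 3 eps, one comes from q^(-L) against 1/e and two from the threshold, as M <= (|X| + 1)
    max f <= 2 |X| max f for nonempty X. *)
Lemma final_labelling_bound B (c eps : R) :
  0 <= c -> c <= 1 -> curvature f <= c -> L%:R^-1 <= eps ->
  L%:R * potential_factor R L <= B%:R ->
  forall O, O \in I ->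
    (1 - c / expR 1 - 3 * eps) * f O <= f (labelled (final_labelling L f I B) setT).
Proof.
move=> c0 c1 fc Leps hB O OI.
have AI := final_labelling_indep B.
set A := labelled _ _ in AI *.
have [neg|pos] := leP (1 - c / expR 1 - 3 * eps) 0.
  by apply: le_trans (f_ge0 A); rewrite mulr_le0_ge0.
have [I0 _ _] := matI.
(* The additive error is relative to the best independent set, so the bound is proved for a
   maximizer M and passed to O, the factor being positive here. *)
case: (@arg_maxP _ _ _ set0 (mem I) f I0) => /= M MI fM.
have loc := local_optimum_bound f_mono f_sub L_gt0 matI AI MI (final_labelling_opt hB)
  threshold_ge0.
apply: (@le_trans _ _ ((1 - c / expR 1 - 3 * eps) * f M)).
  by apply: ler_wpM2l; [exact: ltW | apply: fM].
have fM0 := f_ge0 M.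
have LR : 0 < L%:R :> R by rewrite ltr0n.
have cur : (growth R L ^+ L)^-1 * (f M - f set0 - \sum_(x in M) top_marginal f x)
    <= c / expR 1 * f M + eps * f M.
  have z0 : 0 <= (growth R L ^+ L)^-1 by rewrite invr_ge0 exprn_ge0 // ltW ?growth_gt0.
  apply: (le_trans (ler_wpM2l z0 (curvature_le M c0 fc))).
  rewrite mulrA -mulrDl ler_wpM2r //.
  apply: (@le_trans _ _ (((expR 1)^-1 + L%:R^-1) * c)).
    by rewrite ler_wpM2r // inv_growth_le.
  rewrite mulrDl [_^-1 * c]mulrC lerD2l; apply: le_trans Leps.
  by rewrite ler_piMr // invr_ge0 ler0n.
have err : #|M|%:R * threshold f I L <= 2 * eps * f M.
  have [n0|n0] := posnP #|X|.
    have -> : #|M| = 0%N by apply/eqP; rewrite -leqn0 -n0 max_card.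
    rewrite mul0r !mulr_ge0 //; apply: le_trans Leps; by rewrite invr_ge0 ler0n.
  have nR : 0 < #|X|%:R :> R by rewrite ltr0n.
  apply: (@le_trans _ _ (#|X|%:R * threshold f I L)).
    by rewrite ler_wpM2r ?threshold_ge0 // ler_nat max_card.
  have -> : #|X|%:R * threshold f I L = L%:R^-1 * (singleton_mass f I / #|X|%:R).
    by rewrite /threshold; field; rewrite !gt_eqF.
  have le2 : singleton_mass f I / #|X|%:R <= 2 * f M.
    rewrite ler_pdivrMr //; apply: le_trans (singleton_mass_le fM) _.
    have n1 : 1 <= #|X|%:R :> R by rewrite ler1n.
    by rewrite mulrAC; apply: ler_wpM2r => //; rewrite -natr1; lra.
  apply: (le_trans (ler_wpM2l _ le2)); first by rewrite invr_ge0 ler0n.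
  by rewrite [2 * eps]mulrC -mulrA ler_wpM2r // mulr_ge0.
by move: loc cur err; lra.
Qed.

End Guarantee.

(** * Total correctness and running time of programs *)

(** Every [While] is charged n iterations, which is justified only for loops over X, by [wp_for].
    Adding both branches of [If] keeps the expression polynomial. *)
Fixpoint running_time (n : nat) (c : cmd) : nat :=
  match c with
  | Seq c1 c2 | If _ c1 c2 => (running_time n c1 + running_time n c2).+1
  | While _ c1 => (n * (running_time n c1).+1).+1
  | _ => 1
  end.

Lemma running_time_poly c : exists p : {poly nat}, forall n, running_time n c = p.[n].
Proof.
have pS (p : {poly nat}) n : (p.[n]).+1 = (p + 1%:P).[n].
  by rewrite hornerD hornerC -addn1.
elim: c => /= [|a e|a e|a b|a b|a|c1 [p1 e1] c2 [p2 e2]|b c1 [p1 e1] c2 [p2 e2]|b c1 [p1 e1]];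
  try by exists 1%:P => n; rewrite hornerC.
- by exists (p1 + p2 + 1%:P) => n; rewrite -pS hornerD e1 e2.
- by exists (p1 + p2 + 1%:P) => n; rewrite -pS hornerD e1 e2.
- exists ('X * (p1 + 1%:P) + 1%:P) => n.
  by rewrite -pS mulrC hornerMX -pS e1 mulnC.
Qed.

Definition reg (i : nat) : nexp := NCell (NConst i).

(* Cell 0 holds [#|X|]. *)
Definition for_loop (i : nat) (body : cmd) : cmd :=
  Seq (NSet (NConst i) (NConst 0))
      (While (BLeN (NAdd (reg i) (NConst 1)) (reg 0))
             (Seq body (NSet (NConst i) (NAdd (reg i) (NConst 1))))).

Section Logic.
Variables (R : realType) (X : finType) (f : {set X} -> R) (I : {set {set X}}).
Implicit Types (c : cmd) (s : state R) (Q : state R -> Prop).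

(** Total correctness together with the step bound; quantifying over the remaining stack k is what
    makes it compositional. *)
Definition wp c s Q : Prop := exists m s',
  [/\ (m <= running_time #|X| c)%N,
      forall k, iter m (step f I) (c :: k, s) = (k, s') & Q s'].

Lemma wp_conseq c s Q Q' : wp c s Q -> (forall s', Q s' -> Q' s') -> wp c s Q'.
Proof. by case=> m [s' [? ? q]] QQ'; exists m, s'; split=> //; apply: QQ'. Qed.

Lemma wp_skip s Q : Q s -> wp Skip s Q.
Proof. by move=> q; exists 1%N, s. Qed.

Lemma wp_nset a e s Q :
  Q (nwrite s (neval (nmem s) a) (neval (nmem s) e)) -> wp (NSet a e) s Q.
Proof. by move=> q; eexists 1%N, _; split; last exact: q. Qed.

Lemma wp_rset a e s Q :
  Q (rwrite s (neval (nmem s) a) (reval s e)) -> wp (RSet a e) s Q.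
Proof. by move=> q; eexists 1%N, _; split; last exact: q. Qed.

Lemma wp_value a b s Q :
  Q (rwrite s (neval (nmem s) a) (f (set_at X (nmem s) (neval (nmem s) b)))) ->
  wp (Value a b) s Q.
Proof. by move=> q; eexists 1%N, _; split; last exact: q. Qed.

Lemma wp_indep a b s Q :
  Q (nwrite s (neval (nmem s) a) (set_at X (nmem s) (neval (nmem s) b) \in I)) ->
  wp (Indep a b) s Q.
Proof. by move=> q; eexists 1%N, _; split; last exact: q. Qed.

Lemma wp_seq c1 c2 s Q : wp c1 s (fun s1 => wp c2 s1 Q) -> wp (Seq c1 c2) s Q.
Proof.
case=> m1 [s1 [t1 e1 [m2 [s2 [t2 e2 q]]]]]; exists ((m2 + m1).+1)%N, s2.
split=> // [|k]; first by rewrite /= ltnS addnC leq_add.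
by rewrite iterSr /= iterD e1 e2.
Qed.

Lemma wp_if b c1 c2 s Q :
  (beval s b -> wp c1 s Q) -> (~~ beval s b -> wp c2 s Q) -> wp (If b c1 c2) s Q.
Proof.
case: (boolP (beval s b)) => [bt|bf] h1 h2.
  have [m [s' [t e q]]] := h1 isT; exists m.+1, s'; split=> // [|k].
    by rewrite /= ltnS (leq_trans t) ?leq_addr.
  by rewrite iterSr /= bt.
have [m [s' [t e q]]] := h2 isT; exists m.+1, s'; split=> // [|k].
  by rewrite /= ltnS (leq_trans t) ?leq_addl.
by rewrite iterSr /= (negPf bf).
Qed.

(** The invariant is indexed by the list of visited elements, matching folds and sums over [enum X].
    It is required after the counter increment, which is not part of [body]. *)
Lemma wp_for (Inv : seq X -> state R -> Prop) i body s Q :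
  i != 0%N -> nmem s 0 = #|X| -> Inv [::] (nwrite s i 0) ->
  (forall l x s', nmem s' 0 = #|X| -> nmem s' i = enum_rank x -> Inv l s' ->
     wp body s' (fun s'' => [/\ nmem s'' 0 = #|X|, nmem s'' i = enum_rank x &
       Inv (rcons l x) (nwrite s'' i (enum_rank x).+1)])) ->
  (forall s', nmem s' 0 = #|X| -> Inv (enum X) s' -> Q s') ->
  wp (for_loop i body) s Q.
Proof.
move=> i0 s0 inv0 invS invQ.
set body' := Seq body (NSet (NConst i) (NAdd (reg i) (NConst 1))).
set loop := While (BLeN (NAdd (reg i) (NConst 1)) (reg 0)) body'.
have bodyP l x s' : nmem s' 0 = #|X| -> nmem s' i = enum_rank x -> Inv l s' ->
    wp body' s' (fun s'' => [/\ nmem s'' 0 = #|X|, nmem s'' i = (enum_rank x).+1 &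
      Inv (rcons l x) s'']).
  move=> n0 ni il; apply: wp_seq; apply: wp_conseq (invS _ _ _ n0 ni il) _.
  move=> s2 [m0 mi il2]; apply: wp_nset; rewrite /= mi addn1.
  by rewrite eq_sym (negPf i0) eqxx; split.
(* With j iterations left, each costs one test and one body; the last unit is the failing test. *)
have loopP j k s' : (j + k = #|X|)%N -> nmem s' 0 = #|X| -> nmem s' i = k ->
    Inv (take k (enum X)) s' ->
    exists m s'', [/\ (m <= (j * (running_time #|X| body').+1).+1)%N,
      forall st, iter m (step f I) (loop :: st, s') = (st, s'') & Q s''].
  elim: j k s' => [|j IH] k s' jk n0 ni il.
    exists 1%N, s'; split=> // [st|].
      by rewrite /= n0 ni -jk add0n addn1 ltnn.
    by apply: invQ => //; move: il; rewrite take_oversize // -cardE -jk.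
  have ltk : (k < #|X|)%N by rewrite -jk addSn ltnS leq_addl.
  pose x := enum_val (Ordinal ltk); have rx : enum_rank x = k :> nat.
    by rewrite enum_valK.
  have [m1 [s1 [t1 e1 [n1 i1 il1]]]] := bodyP _ x _ n0 (etrans ni (esym rx)) il.
  have [|||m2 [s2 [t2 e2 q2]]] := IH k.+1 s1 _ n1.
  - by rewrite addnS -jk addSn.
  - by rewrite i1 rx.
  - rewrite (take_nth x) -?cardE // -[in nth _ _ _]rx nth_enum_rank //.
  exists ((m2 + m1).+1)%N, s2; split=> // [|st].
    by move: t1 t2; rewrite mulSn; set r := running_time _ body'; lia.
  by rewrite iterSr /= n0 ni addn1 ltk iterD e1 e2.
have n1 : nmem (nwrite s i 0) 0 = #|X| by rewrite /= eq_sym (negPf i0).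
have [|||m [s' [t e q]]] := loopP #|X| 0%N (nwrite s i 0) _ n1.
- by rewrite addn0.
- by rewrite /= eqxx.
- by rewrite take0.
exists m.+2, s'; split=> // k; rewrite !iterSr /=; exact: e.
Qed.

Lemma wp_run c Q r T : wp c (init R X c r).2 Q ->
  (running_time #|X| c <= T)%N ->
  halted (run f I c T r) /\ Q (run f I c T r).2.
Proof.
case=> m [s' [t e q]] leT; rewrite /run -(subnK (leq_trans t leT)) iterD.
rewrite {}(e [::]); elim: (_ - _)%N => [|j [h q']] //=.
by case: (iter _ _ _) h q' => -[|? ?].
Qed.

End Logic.

(** * The program *)

(* Memory map: the labels start at address 16 and the characteristic vector   *)
(* of the current query at address [16 + #|X|].  Natural-number cells 1 to 6  *)
(* are loop counters, 7 is an independence flag, 8 and 9 save labels.  Real   *)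
(* cell 0 receives query values, 1 is an accumulator, 2 holds the potential   *)
(* of the current labelling and 3 the threshold.                              *)
Definition lab_at (e : nexp) : nexp := NAdd (NConst 16) e.
Definition query_base : nexp := NAdd (NConst 16) (reg 0).

Definition eq_test (e1 e2 : nexp) : bexp := BAnd (BLeN e1 e2) (BLeN e2 e1).
Definition true_test : bexp := BLeN (NConst 0) (NConst 0).

(* The element tested is the one of rank [reg 1].                             *)
Definition label_test (L : nat) (J : {set 'I_L}) : bexp :=
  foldr (fun (j : 'I_L) b =>
           BNot (BAnd (BNot (eq_test (NCell (lab_at (reg 1))) (NConst j.+1))) (BNot b)))
        (BNot true_test) (enum J).

Definition fill (b : bexp) : cmd :=
  for_loop 1 (If b (NSet (NAdd query_base (reg 1)) (NConst 1))
                   (NSet (NAdd query_base (reg 1)) (NConst 0))).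

Definition query (b : bexp) : cmd := Seq (fill b) (Value (NConst 0) query_base).

Definition add_scaled (e : rexp) : cmd :=
  RSet (NConst 1) (RAdd (RCell (NConst 1)) (RMul e (RCell (NConst 0)))).

Definition query_add (b : bexp) (w : rat) : cmd := Seq (query b) (add_scaled (RConst w)).

Definition seqs (cs : seq cmd) : cmd := foldr Seq Skip cs.

(** The coefficient of l(S_J) once g is expanded as f - l; the linear part of the potential is
    assigned to the full J. *)
Definition top_coef (L : nat) (J : {set 'I_L}) : rat :=
  (if J == setT then growth rat L ^+ L.+1 else 0) - weight rat L #|J|.

(** The loop adds l(x) for x in S_J without branching: it queries X, and X minus x if x is in S_J,
    with opposite coefficients, so elements outside S_J cancel. *)
Definition add_level (L : nat) (J : {set 'I_L}) : cmd :=
  Seq (query_add (label_test J) (weight rat L #|J|))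
      (for_loop 2
        (Seq (query_add true_test (top_coef J))
             (query_add (BNot (BAnd (eq_test (reg 1) (reg 2)) (label_test J)))
                        (- top_coef J)))).

Definition compute_potential (L : nat) : cmd :=
  Seq (RSet (NConst 1) (RConst 0))
      (seqs [seq add_level J | J <- enum {set 'I_L}]).

Definition compute_mass : cmd :=
  Seq (query_add (BNot true_test) 1)
      (for_loop 2 (Seq (query (eq_test (reg 1) (reg 2)))
                  (Seq (Indep (NConst 7) query_base) (add_scaled (ROfNat (reg 7)))))).

(** Clearing u before labelling v agrees with [relabel] when u = v. On rejection both saved labels
    are written back. *)
Definition try_relabel (L : nat) (j : 'I_L) : cmd :=
  seqs [:: NSet (NConst 8) (NCell (lab_at (reg 3)));
           NSet (NConst 9) (NCell (lab_at (reg 4)));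
           NSet (lab_at (reg 3)) (NConst 0);
           NSet (lab_at (reg 4)) (NConst j.+1);
           Indep (NConst 7) (NConst 16);
           compute_potential L;
           If (BAnd (BLeN (NConst 1) (reg 7))
                    (BNot (BLeR (RCell (NConst 1))
                                (RAdd (RCell (NConst 2)) (RCell (NConst 3))))))
              (RSet (NConst 2) (RCell (NConst 1)))
              (Seq (NSet (lab_at (reg 4)) (reg 9)) (NSet (lab_at (reg 3)) (reg 8)))].

Definition run_pass (L : nat) : cmd :=
  for_loop 3 (for_loop 4 (seqs [seq try_relabel j | j <- enum 'I_L])).

(** Two loops over X around B copies of a pass give the |X|^2 B passes. Only at the end is |X| in
    cell 0 overwritten, by the address of the answer. *)
Definition local_search (L B : nat) : cmd :=
  seqs [:: compute_mass;
           RSet (NConst 3) (RDiv (RMul (RConst L%:R^-1) (RCell (NConst 1)))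
                                 (RMul (ROfNat (reg 0)) (ROfNat (reg 0))));
           compute_potential L;
           RSet (NConst 2) (RCell (NConst 1));
           for_loop 5 (for_loop 6 (seqs (nseq B (run_pass L))));
           NSet (NConst 0) (NConst 16)].

(** * Correctness of the program *)

Section Program.
Variables (R : realType) (X : finType) (f : {set X} -> R) (I : {set {set X}}).
Implicit Types (s : state R) (D : seq nat).

(** Leaves free the query area above the labels and the real cells 0 and 1, which every query may
    overwrite. *)
Definition frame D s s' : Prop :=
  (forall a, (a < 16 + #|X|)%N -> a \notin D -> nmem s' a = nmem s a) /\
  (forall a, (2 <= a)%N -> rmem s' a = rmem s a).

Lemma frame_trans D s1 s2 s3 : frame D s1 s2 -> frame D s2 s3 -> frame D s1 s3.
Proof.
move=> [n1 r1] [n2 r2]; split=> a *; first by rewrite n2 // n1.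
by rewrite r2 // r1.
Qed.

Lemma frame_sub D D' s s' : {subset D <= D'} -> frame D s s' -> frame D' s s'.
Proof.
by move=> sD [n r]; split=> // a la aD; apply: n => //; apply: contra aD; apply: sD.
Qed.

Lemma frame_nwrite D s a v :
  (a \in D) || (16 + #|X| <= a)%N -> frame D s (nwrite s a v).
Proof.
move=> h; split=> // b lb bD /=; case: eqVneq => // e; move: h.
by rewrite -e (negPf bD) /= leqNgt lb.
Qed.

Lemma frame_rwrite D s a v : (a < 2)%N -> frame D s (rwrite s a v).
Proof. by move=> h; split=> // b lb /=; case: eqVneq => // e; lia. Qed.

Lemma rank_lt (x : X) : (enum_rank x < #|X|)%N.
Proof. exact: ltn_ord. Qed.

Lemma wp_fill b (P : pred X) s : nmem s 0 = #|X| ->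
  (forall s' x, frame [:: 1%N] s s' -> nmem s' 1%N = enum_rank x -> beval s' b = P x) ->
  wp f I (fill b) s (fun s' => [/\ frame [:: 1%N] s s', rmem s' = rmem s &
    set_at X (nmem s') (16 + #|X|) = [set x | P x]]).
Proof.
move=> n0 bP.
apply: (@wp_for _ _ _ _ (fun l s' => [/\ frame [:: 1%N] s s', rmem s' = rmem s &
  forall y, y \in l -> (nmem s' (16 + #|X| + enum_rank y)%N != 0%N) = P y])) => //.
- by split=> //; apply: frame_nwrite.
- move=> l x s' n0' n1 [fr er IH]; have bx := bP _ _ fr n1.
  have post v : (v != 0%N) = P x ->
      wp f I (NSet (NAdd query_base (reg 1)) (NConst v)) s' (fun s'' =>
      [/\ nmem s'' 0 = #|X|, nmem s'' 1%N = enum_rank x &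
       [/\ frame [:: 1%N] s (nwrite s'' 1 (enum_rank x).+1),
        rmem (nwrite s'' 1 (enum_rank x).+1) = rmem s &
        forall y, y \in rcons l x ->
        (nmem (nwrite s'' 1 (enum_rank x).+1) (16 + #|X| + enum_rank y)%N != 0%N) = P y]]).
    move=> vP; apply: wp_nset; rewrite /= n0' n1; split=> //; split=> //.
      apply: (frame_trans fr); apply: frame_trans (frame_nwrite _ _ _); last by [].
      by apply: frame_nwrite; rewrite leq_addr orbT.
    move=> y; rewrite mem_rcons inE eqn_add2l /= => yl.
    case: (eqVneq (enum_rank y : nat) (enum_rank x)) => [/ord_inj/enum_rank_inj->//|ne].
    apply: IH; case/orP: yl => // /eqP e; by rewrite e eqxx in ne.
  by apply: wp_if; rewrite bx => Px; apply: post; rewrite ?Px // (negPf Px).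
- move=> s' _ [fr er h]; split=> //; apply/setP => y.
  by rewrite !inE h // mem_enum.
Qed.

Lemma wp_query b (P : pred X) s Q : nmem s 0 = #|X| ->
  (forall s' x, frame [:: 1%N] s s' -> nmem s' 1%N = enum_rank x -> beval s' b = P x) ->
  (forall s', frame [:: 1%N] s s' -> rmem s' 1%N = rmem s 1%N ->
     rmem s' 0 = f [set x | P x] ->
     set_at X (nmem s') (16 + #|X|) = [set x | P x] -> Q s') ->
  wp f I (query b) s Q.
Proof.
move=> n0 bP h; apply: wp_seq; apply: wp_conseq (wp_fill n0 bP) _ => s' [fr er e].
have n0' : nmem s' 0 = #|X| by rewrite fr.1.
apply: wp_value; rewrite /= n0' e; apply: h => //=; last by rewrite er.
exact: frame_trans fr (frame_rwrite _ _ _ _).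
Qed.

Lemma wp_query_add b (P : pred X) w s Q : nmem s 0 = #|X| ->
  (forall s' x, frame [:: 1%N] s s' -> nmem s' 1%N = enum_rank x -> beval s' b = P x) ->
  (forall s', frame [:: 1%N] s s' ->
     rmem s' 1%N = rmem s 1%N + ratr w * f [set x | P x] -> Q s') ->
  wp f I (query_add b w) s Q.
Proof.
move=> n0 bP h; apply: wp_seq; apply: (wp_query n0 bP) => s' fr e1 e0 _.
apply: wp_rset; apply: h => /=; last by rewrite e1 e0.
exact: frame_trans fr (frame_rwrite _ _ _ _).
Qed.

Section Labelled.
Variable L : nat.
Implicit Types (lab : {ffun X -> option 'I_L}) (J : {set 'I_L}).

(** With 0 for unlabelled elements, the label array is itself a characteristic vector of A, and the
    initial memory encodes the empty labelling. *)
Definition code (o : option 'I_L) : nat := if o is Some j then j.+1 else 0.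

Definition stores lab s : Prop :=
  nmem s 0 = #|X| /\ forall x, nmem s (16 + enum_rank x)%N = code (lab x).

Lemma frame_stores D lab s s' : frame D s s' ->
  all (fun a => 0 < a < 16)%N D -> stores lab s -> stores lab s'.
Proof.
move=> [fr _] /allP DP [n0 h]; have nD a : ~~ (0 < a < 16)%N -> a \notin D.
  by apply: contra => /DP.
split=> [|x]; rewrite fr ?nD //; try lia.
by rewrite ltn_add2l rank_lt.
Qed.

Lemma label_testP lab J s x : stores lab s -> nmem s 1%N = enum_rank x ->
  beval s (label_test J) = (x \in labelled lab J).
Proof.
move=> [n0 h] n1; rewrite inE.
have e : nmem s (16 + nmem s 1%N)%N = code (lab x) by rewrite n1 h.
have -> : beval s (label_test J) = has (fun j : 'I_L => lab x == Some j) (enum J).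
  rewrite /label_test; elim: (enum J) => //= j l ->; rewrite e -eqn_leq.
  rewrite negb_and !negbK; congr (_ || _).
  by case: (lab x) => [i|] //=; rewrite eqSS; apply/eqP/eqP => [/ord_inj->|[->]].
case: (lab x) => [i|]; last by apply/hasP => -[].
apply/hasP/idP => [[j]|iJ]; first by rewrite mem_enum => jJ /eqP[->].
by exists i; rewrite ?mem_enum.
Qed.

Lemma ratr_growth : ratr (growth rat L) = growth R L.
Proof. by rewrite /growth rmorphD rmorph1 fmorphV /= ratr_nat. Qed.

Lemma ratr_weight k : ratr (weight rat L k) = weight R L k.
Proof.
by rewrite /weight rmorphM fmorphV rmorphXn /= ratr_growth rmorphM /= !ratr_nat.
Qed.

Lemma wp_add_level J lab s Q : stores lab s ->
  (forall s', frame [:: 1%N; 2%N] s s' ->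
    rmem s' 1%N = rmem s 1%N + (ratr (weight rat L #|J|) * f (labelled lab J) +
      ratr (top_coef J) * \sum_(x in labelled lab J) top_marginal f x) -> Q s') ->
  wp f I (add_level J) s Q.
Proof.
move=> st h; apply: wp_seq; have n0 := st.1.
have stf D s1 : frame D s s1 -> all (fun a => 0 < a < 16)%N D -> stores lab s1.
  by move=> fr DP; apply: frame_stores fr DP st.
apply: (wp_query_add (P := fun x => x \in labelled lab J) n0) => [s' x fr n1|s1 fr1 e1].
  exact: label_testP (stf _ _ fr isT) n1.
rewrite (_ : [set x | x \in labelled lab J] = labelled lab J) in e1; last first.
  by apply/setP => x; rewrite inE.
have sub12 : {subset [:: 1%N] <= [:: 1%N; 2%N]} by move=> a; rewrite !inE => ->.
apply: (@wp_for _ _ _ _ (fun l s' => frame [:: 1%N; 2%N] s s' /\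
  rmem s' 1%N = rmem s1 1%N +
   ratr (top_coef J) * \sum_(x <- l | x \in labelled lab J) top_marginal f x)) => //.
- by rewrite fr1.1.
- rewrite big_nil mulr0 addr0; split=> //.
  exact: frame_trans (frame_sub sub12 fr1) (frame_nwrite _ _ _).
- move=> l x s2 n02 nx [fr2 e2]; apply: wp_seq.
  apply: (wp_query_add (P := predT)) => // s3 fr3 e3.
  have fr23 := frame_trans fr2 (frame_sub sub12 fr3).
  have nx3 : nmem s3 2%N = enum_rank x by rewrite fr3.1.
  apply: (wp_query_add (P := fun y => ~~ ((y == x) && (y \in labelled lab J)))).
  + by rewrite fr3.1.
  + move=> s4 y fr4 ny /=.
    have st4 := stf _ s4 (frame_trans fr23 (frame_sub sub12 fr4)) isT.
    have nx4 : nmem s4 2%N = enum_rank x by rewrite fr4.1.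
    rewrite (label_testP _ st4 ny) ny nx4 -eqn_leq; congr (~~ (_ && _)).
    by apply/eqP/eqP => [/ord_inj/enum_rank_inj|->].
  move=> s4 fr4 e4; split.
  + by rewrite fr4.1 // fr3.1.
  + by rewrite fr4.1.
  split.
    apply: frame_trans fr23 (frame_trans (frame_sub sub12 fr4) _).
    exact: frame_nwrite.
  rewrite /= e4 e3 e2 big_rcons /= rmorphN.
  have -> : [set y | predT y] = setT :> {set X} by apply/setP => y; rewrite !inE.
  case: ifP => xJ.
    have -> : [set y | ~~ ((y == x) && (y \in labelled lab J))] = ~: [set x].
      by apply/setP => y; rewrite !inE; case: eqVneq => // ->; move: xJ; rewrite inE => ->.
    by rewrite /top_marginal; ring.
  have -> : [set y | ~~ ((y == x) && (y \in labelled lab J))] = setT.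
    by apply/setP => y; rewrite !inE; case: eqVneq => // ->; move: xJ; rewrite inE => ->.
  by ring.
- move=> s' _ [fr e]; apply: h => //; rewrite e e1 -addrA; congr (_ + (_ + _ * _)).
  by rewrite big_enum_cond.
Qed.

Lemma wp_compute_potential lab s Q : stores lab s ->
  (forall s', frame [:: 1%N; 2%N] s s' -> rmem s' 1%N = potential f lab -> Q s') ->
  wp f I (compute_potential L) s Q.
Proof.
move=> st h; apply: wp_seq; apply: wp_rset; rewrite /= raddf0.
set s0 := rwrite s 1 0.
have fr0 : frame [:: 1%N; 2%N] s s0 by apply: frame_rwrite.
have st0 := frame_stores fr0 isT st.
pose term J := ratr (weight rat L #|J|) * f (labelled lab J) +
      ratr (top_coef J) * \sum_(x in labelled lab J) top_marginal f x : R.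
(* The linear part is spread over all J with coefficient zero off the full set, giving one summand
   per [add_level]. *)
have pot : potential f lab = 0 + \sum_(J <- enum {set 'I_L}) term J.
  rewrite add0r big_enum /= /potential.
  have -> : growth R L ^+ L.+1 * \sum_(x in labelled lab setT) top_marginal f x =
     \sum_J (if J == setT then growth R L ^+ L.+1 else 0) *
         \sum_(x in labelled lab J) top_marginal f x.
    rewrite (bigD1 setT) //= eqxx [X in _ + X]big1 ?addr0 // => J /negPf->.
    by rewrite mul0r.
  rewrite -big_split /=; apply: eq_bigr => J _.
  rewrite /term /residual /top_coef rmorphB /= ratr_weight.
  have -> : ratr (if J == setT then growth rat L ^+ L.+1 else 0) =
     (if J == setT then growth R L ^+ L.+1 else 0) :> R.
    by case: ifP; rewrite ?rmorph0 // rmorphXn /= ratr_growth.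
  move: (if _ then _ else _) (weight _ _ _) (\sum_(x in _) _) => b w t.
  by ring.
suff : forall l s1 a, frame [:: 1%N; 2%N] s s1 -> rmem s1 1%N = a ->
    (forall s', frame [:: 1%N; 2%N] s s' -> rmem s' 1%N = a + \sum_(J <- l) term J -> Q s') ->
    wp f I (seqs [seq add_level J | J <- l]) s1 Q.
  move=> H; apply: (H _ _ 0 fr0) => [|s' fr e] //.
  by apply: h => //; rewrite pot.
elim=> [|J l IH] s1 a fr1 e1 HQ /=.
  by apply: wp_skip; apply: HQ => //; rewrite big_nil addr0.
apply: wp_seq; apply: (wp_add_level (frame_stores fr1 isT st)) => s2 fr2 e2.
apply: (IH _ _ (frame_trans fr1 fr2) e2) => s' fr e; apply: HQ => //.
by rewrite e e1 big_cons -addrA.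
Qed.

Lemma wp_compute_mass s Q : nmem s 0 = #|X| -> rmem s 1%N = 0 ->
  (forall s', frame [:: 1%N; 2%N; 7%N] s s' -> rmem s' 1%N = singleton_mass f I -> Q s') ->
  wp f I compute_mass s Q.
Proof.
move=> n0 a0 h; apply: wp_seq.
have sub1 : {subset [:: 1%N] <= [:: 1%N; 2%N; 7%N]} by move=> a; rewrite !inE => ->.
apply: (wp_query_add (P := pred0)) => // s1 fr1 e1.
rewrite a0 add0r rmorph1 mul1r in e1.
rewrite (_ : [set x | pred0 x] = set0) in e1; last by apply/setP => x; rewrite !inE.
apply: (@wp_for _ _ _ _ (fun l s' => frame [:: 1%N; 2%N; 7%N] s s' /\
  rmem s' 1%N = f set0 + \sum_(x <- l | [set x] \in I) f [set x])) => //.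
- by rewrite fr1.1.
- rewrite big_nil addr0; split=> //.
  exact: frame_trans (frame_sub sub1 fr1) (frame_nwrite _ _ _).
- move=> l x s2 n02 nx [fr2 e2]; apply: wp_seq.
  apply: (wp_query (P := pred1 x)) => // [s3 y fr3 ny|s3 fr3 e31 e30 es].
    have nx3 : nmem s3 2%N = enum_rank x by rewrite fr3.1.
    rewrite /= ny nx3 -eqn_leq.
    by apply/eqP/eqP => [/ord_inj/enum_rank_inj|->].
  rewrite (_ : [set y | pred1 x y] = [set x]) in e30 es; last first.
    by apply/setP => y; rewrite !inE.
  have n03 : nmem s3 0 = #|X| by rewrite fr3.1.
  apply: wp_seq; apply: wp_indep; apply: wp_rset; rewrite /= n03 es; split=> //=.
  + by rewrite fr3.1.
  split.
    apply: frame_trans fr2 (frame_trans (frame_sub sub1 fr3) _).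
    apply: (@frame_trans _ _ (nwrite s3 7 ([set x] \in I))); first exact: frame_nwrite.
    exact: frame_trans (frame_rwrite _ _ _ _) (frame_nwrite _ _ _).
  rewrite e31 e30 e2 big_rcons /=.
  by case: ([set x] \in I); rewrite ?mul1r ?mul0r ?addr0; ring.
- by move=> s' _ [fr e]; apply: h => //; rewrite e big_enum_cond.
Qed.

Definition set_label lab x (o : option 'I_L) : {ffun X -> option 'I_L} :=
  [ffun y => if y == x then o else lab y].

Definition same (D : pred nat) s s' : Prop := forall a, D a -> nmem s' a = nmem s a.

Lemma wp_set_label lab r x o e s Q : stores lab s -> nmem s r = enum_rank x ->
  neval (nmem s) e = code o ->
  (forall s', stores (set_label lab x o) s' -> same (gtn 16) s s' -> rmem s' = rmem s ->
     Q s') ->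
  wp f I (NSet (lab_at (reg r)) e) s Q.
Proof.
move=> [n0 h] nr ee HQ; apply: wp_nset; apply: HQ => //=; rewrite nr ee.
  split=> [//|y]; rewrite /= ffunE eqn_add2l.
  by rewrite (inj_eq (@ord_inj _)) (inj_eq enum_rank_inj); case: ifP.
by move=> a /= la; case: eqVneq => // e1; move: la; rewrite e1 /=; lia.
Qed.

Lemma wp_save_label lab a r x s Q : (0 < a < 16)%N -> stores lab s ->
  nmem s r = enum_rank x ->
  (forall s', stores lab s' -> nmem s' a = code (lab x) ->
     same (predC1 a) s s' -> rmem s' = rmem s -> Q s') ->
  wp f I (NSet (NConst a) (NCell (lab_at (reg r)))) s Q.
Proof.
move=> la [n0 h] nr HQ; apply: wp_nset; apply: HQ => //=.
- split=> [|y] /=; first by case: eqVneq => // e; rewrite -e in la.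
  by case: eqVneq => // e; move: la; rewrite -e; lia.
- by rewrite eqxx nr h.
- by move=> b /= /negPf->.
Qed.

Definition search_state (tau : R) lab s : Prop :=
  [/\ stores lab s, rmem s 2%N = potential f lab & rmem s 3%N = tau].

Lemma search_state_nwrite tau lab s a v : (0 < a < 16)%N ->
  search_state tau lab s -> search_state tau lab (nwrite s a v).
Proof.
move=> la [st e2 e3]; split=> //; apply: (@frame_stores [:: a] lab s _ _ _ st); last by rewrite /= la.
by apply: frame_nwrite; rewrite inE eqxx.
Qed.

Lemma stores_set_at lab s : stores lab s -> set_at X (nmem s) 16 = labelled lab setT.
Proof.
move=> [_ h]; apply/setP => x; rewrite !inE h.
by case: (lab x) => //= j; rewrite inE.
Qed.

Lemma wp_try_relabel tau lab u v j s Q : search_state tau lab s ->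
  nmem s 3%N = enum_rank u -> nmem s 4%N = enum_rank v ->
  (forall s', search_state tau (try_move f I tau u v lab j) s' ->
     same (fun a => 3 <= a < 7)%N s s' -> Q s') ->
  wp f I (try_relabel j) s Q.
Proof.
move=> [st e2 e3] n3 n4 HQ.
pose lab' := relabel lab u v j.
apply: wp_seq; apply: (wp_save_label _ st n3) => // s1 st1 o1 k1 r1.
have n41 : nmem s1 4%N = enum_rank v by rewrite k1.
apply: wp_seq; apply: (wp_save_label _ st1 n41) => // s2 st2 o2 k2 r2.
have n32 : nmem s2 3%N = enum_rank u by rewrite k2 // k1.
apply: wp_seq; apply: (wp_set_label (o := None) st2 n32) => // s3 st3 k3 r3.
have n43 : nmem s3 4%N = enum_rank v by rewrite k3 // k2.
apply: wp_seq; apply: (wp_set_label (o := Some j) st3 n43) => // s4 st4 k4 r4.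
have lab'E : set_label (set_label lab u None) v (Some j) = lab'.
  by apply/ffunP => x; rewrite !ffunE.
rewrite {}lab'E in st4.
apply: wp_seq; apply: wp_indep; rewrite /= (stores_set_at st4).
set b := _ \in I; set s5 := nwrite s4 7 b.
have fr5 : frame [:: 7%N] s4 s5 by apply: frame_nwrite.
have st5 := frame_stores fr5 isT st4.
apply: wp_seq; apply: (wp_compute_potential st5) => s6 fr6 e6.
have st6 := frame_stores fr6 isT st5.
have r6 a : (2 <= a)%N -> rmem s6 a = rmem s a by move=> la; rewrite fr6.2 //= r4 r3 r2 r1.
have k64 a : (2 < a < 16)%N -> a != 7%N -> nmem s6 a = nmem s4 a.
  move=> la a7; rewrite fr6.1 ?fr5.1 ?inE //; lia.
have b6 : nmem s6 7%N = b by rewrite fr6.1.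
have keep : same (fun a => 3 <= a < 7)%N s s6.
  move=> a la.
  by rewrite k64 ?k4 ?k3 ?k2 ?k1 /=; lia.
have o86 : nmem s6 8%N = code (lab u) by rewrite k64 // k4 // k3 // k2.
have o96 : nmem s6 9%N = code (lab v) by rewrite k64 // k4 // k3.
apply: wp_seq; apply: wp_if => /=; rewrite b6 e6 (r6 2%N) // e2 (r6 3%N) // e3 => test.
  apply: wp_rset; apply: wp_skip; apply: HQ => //=.
  rewrite /try_move -/lab' (_ : (_ && _) = true); last first.
    by move: test; rewrite /b; case: (_ \in I).
  by split=> //=; rewrite r6.
have n46 : nmem s6 4%N = enum_rank v by rewrite keep.
apply: wp_seq; apply: (wp_set_label (o := lab v) st6 n46) => // s7 st7 k7 r7.
have n37 : nmem s7 3%N = enum_rank u by rewrite k7 // keep.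
have o87 : nmem s7 8%N = code (lab u) by rewrite k7.
apply: (wp_set_label (o := lab u) st7 n37) => // s8 st8 k8 r8.
apply: wp_skip; apply: HQ; last first.
  move=> a aD; have a16 : gtn 16 a by move: aD => /=; lia.
  by rewrite -keep // k8 // k7.
rewrite /try_move -/lab' (_ : (_ && _) = false); last first.
  by move: test; rewrite /b; case: (_ \in I) => //= /negPf.
have labE : set_label (set_label lab' v (lab v)) u (lab u) = lab.
  apply/ffunP => x; rewrite !ffunE; case: (eqVneq x u) => [->//|_].
  by case: (eqVneq x v) => [->|].
by rewrite labE in st8; split=> //; rewrite r8 r7 r6.
Qed.

Lemma wp_run_pass tau lab s Q : search_state tau lab s ->
  (forall s', search_state tau (search_pass f I tau lab) s' ->
     same (fun a => 5 <= a < 7)%N s s' -> Q s') ->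
  wp f I (run_pass L) s Q.
Proof.
move=> ss HQ.
have n0 : nmem s 0 = #|X| by case: ss => -[].
apply: (@wp_for _ _ _ _ (fun l s' =>
  search_state tau (foldl (fun lab u => foldl (fun lab v =>
    foldl (try_move f I tau u v) lab (enum 'I_L)) lab (enum X)) lab l) s' /\
  same (fun a => 5 <= a < 7)%N s s')) => //.
- split; first exact: search_state_nwrite.
  by move=> a la /=; case: eqVneq => // e; lia.
- move=> l u s1 n01 nu [ss1 k1].
  set lab1 := foldl _ lab l in ss1.
  apply: (@wp_for _ _ _ _ (fun l s' =>
    search_state tau (foldl (fun lab v =>
      foldl (try_move f I tau u v) lab (enum 'I_L)) lab1 l) s' /\
    [/\ nmem s' 3%N = enum_rank u & same (fun a => 5 <= a < 7)%N s s'])) => //.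
  + split; first exact: search_state_nwrite.
    split=> // a la /=.
    by case: eqVneq => [e|_]; [lia|apply: k1].
  + move=> l' v s2 n02 nv [ss2 [nu2 k2]].
    set lab2 := foldl _ lab1 l' in ss2.
    (* Labels are unrolled in the program text, so the list is handled by induction rather than by
       [wp_for]. *)
    suff : forall js lab3 s3, search_state tau lab3 s3 -> same (fun a => 3 <= a < 7)%N s2 s3 ->
        wp f I (seqs [seq try_relabel j | j <- js]) s3 (fun s' =>
          search_state tau (foldl (try_move f I tau u v) lab3 js) s' /\
          same (fun a => 3 <= a < 7)%N s2 s').
      move=> H; apply: wp_conseq (H _ _ _ ss2 (fun _ _ => erefl)) _ => s' [ss' k'].
      split.
      * by case: ss' => -[].
      * by rewrite k'.
      rewrite foldl_rcons; split; first exact: search_state_nwrite.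
      split; first by rewrite /= k'.
      move=> a aD; rewrite -(k2 a aD) /= -k' //; last first.
        by move: aD; lia.
      by move: aD; case: eqVneq => // e; lia.
    elim=> [|j js IH] lab3 s3 ss3 k3 /=; first exact: wp_skip.
    apply: wp_seq; apply: (wp_try_relabel (u := u) (v := v) ss3) => [||s4 ss4 k4].
    * by rewrite k3.
    * by rewrite k3.
    by apply: IH => // a aD; rewrite k4 // k3.
  + move=> s2 n02 [ss2 [nu2 k2]]; split=> //.
    rewrite foldl_rcons; split; first exact: search_state_nwrite.
    move=> a aD; rewrite -(k2 a aD) /=.
    by move: aD; case: eqVneq => // e; lia.
- by move=> s' _ [ss' k']; apply: HQ.
Qed.

Definition start_labelling : {ffun X -> option 'I_L} := [ffun=> None].

Lemma wp_local_search B c r : wp f I (local_search L B) (init R X c r).2 (fun s =>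
  set_at X (nmem s) (nmem s 0) = labelled (final_labelling L f I B) setT).
Proof.
set s := (init R X c r).2.
have n0 : nmem s 0 = #|X| by [].
have st : stores start_labelling s by split=> // x; rewrite ffunE.
apply: wp_seq; apply: wp_compute_mass => // s1 fr1 e1.
have st1 := frame_stores fr1 isT st.
apply: wp_seq; apply: wp_rset.
set s2 := (X in wp f I _ X _).
have st2 : stores start_labelling s2 by [].
have tau2 : rmem s2 3%N = threshold f I L.
  by rewrite /= e1 st1.1 /threshold fmorphV /= ratr_nat.
apply: wp_seq; apply: (wp_compute_potential st2) => s3 fr3 e3.
have st3 := frame_stores fr3 isT st2.
apply: wp_seq; apply: wp_rset.
set s4 := (X in wp f I _ X _); set tau := threshold f I L in tau2 *.
have ss4 : search_state tau start_labelling s4 by split=> //=; rewrite fr3.2.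
pose pass := search_pass f I tau (L := L).
suff main : wp f I (for_loop 5 (for_loop 6 (seqs (nseq B (run_pass L))))) s4
    (search_state tau (final_labelling L f I B)).
  apply: wp_seq; apply: wp_conseq main _ => s5 [st5 _ _].
  apply: wp_seq; apply: wp_nset; apply: wp_skip.
  rewrite -(stores_set_at st5); apply/setP => x; rewrite !inE /=.
  by [].
apply: (@wp_for _ _ _ _ (fun l s' =>
  search_state tau (iter (size l * (#|X| * B)) pass start_labelling) s')) => //.
- by case: ss4 => -[].
- move=> l x s5 n05 n5 ss5; set lab5 := iter _ _ _ in ss5.
  apply: (@wp_for _ _ _ _ (fun l s' => nmem s' 5%N = enum_rank x /\
    search_state tau (iter (size l * B) pass lab5) s')) => //.
  + move=> l' y s6 n06 n6 [n56 ss6]; set lab6 := iter _ _ _ in ss6.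
    suff : forall m lab7 s7, search_state tau lab7 s7 -> same (fun a => 5 <= a < 7)%N s6 s7 ->
        wp f I (seqs (nseq m (run_pass L))) s7 (fun s' =>
          search_state tau (iter m pass lab7) s' /\ same (fun a => 5 <= a < 7)%N s6 s').
      move=> H; apply: wp_conseq (H _ _ _ ss6 (fun _ _ => erefl)) _ => s' [ss' k'].
      split.
      * by case: ss' => -[].
      * by rewrite k'.
      split; first by rewrite /= k'.
      by rewrite size_rcons mulSn iterD; apply: search_state_nwrite.
    elim=> [|m IH] lab7 s7 ss7 k7 /=; first exact: wp_skip.
    apply: wp_seq; apply: (wp_run_pass ss7) => s8 ss8 k8.
    rewrite -iterS iterSr; apply: IH => // a aD; by rewrite k8 // k7.
  + move=> s6 n06 [n56 ss6]; split=> //.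
    rewrite -cardE in ss6; rewrite size_rcons mulSn iterD.
    exact: search_state_nwrite.
- by move=> s5 _; rewrite -cardE.
Qed.

End Labelled.
End Program.

Theorem theorem7 (R : realType) :
  exists2 K : R, 0 <= K &
  forall (eps c : R), 0 < eps -> 0 <= c -> c <= 1 ->
  forall d : nat,
  exists (P : cmd) (p : {poly nat}),
  forall (X : finType) (f : {set X} -> R) (I : {set {set X}}),
    nonneg f -> nondecreasing_set f -> submodular f -> curvature f <= c ->
    matroid I ->
    let T := p.[#|X|] in
    let S := fun r : T.-tuple bool => output X (run f I P T r) in
    [/\ forall r : T.-tuple bool, halted (run f I P T r),
        forall r : T.-tuple bool, S r \in I &
        1 - (#|X|%:R ^+ d)^-1 <=
        coin_prob R (fun r : T.-tuple bool =>
          [forall O in I, (1 - c / expR 1 - K * eps) * f O <= f (S r)])].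
Proof.
exists 3 => // eps c eps0 c0 c1 d.
(* L makes 1/L at most eps, and B meets the pass count of [final_labelling_opt]; neither depends on
   c or on the instance. *)
pose L := Num.bound eps^-1; pose B := Num.bound (L%:R * potential_factor R L).
have Leps : eps^-1 < L%:R by apply: archi_boundP; rewrite invr_ge0 ltW.
have LR : 0 < L%:R :> R by apply: lt_trans Leps; rewrite invr_gt0.
have L0 : (0 < L)%N by rewrite ltr0n in LR.
have epsL : L%:R^-1 <= eps by rewrite -[eps]invrK lef_pV2 ?posrE ?invr_gt0 // ltW.
have LB : L%:R * potential_factor R L <= B%:R.
  apply/ltW/archi_boundP; rewrite mulr_ge0 ?addr_ge0 ?sumr_ge0 ?ltW // => [J _|].
    exact: weight_ge0.
  by rewrite exprn_gt0 ?growth_gt0.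
have [p pE] := running_time_poly (local_search L B).
exists (local_search L B), p => X f I f0 fm fs fc matI T S.
have runE (r : T.-tuple bool) : halted (run f I (local_search L B) T r) /\
    S r = labelled (final_labelling L f I B) setT.
  by apply: wp_run (wp_local_search _ _ _ _ _ _) _; rewrite pE.
split=> [r|r|]; first exact: (runE r).1.
  by rewrite (runE r).2 final_labelling_indep.
(* The output is the same for every tape, so the success event contains all of them. *)
rewrite /coin_prob (_ : [set r | _] = setT); last first.
  apply/setP => r; rewrite !inE; apply/forall_inP => O OI; rewrite (runE r).2.
  exact: final_labelling_bound.
rewrite cardsT card_tuple card_bool natrX divff ?expf_neq0 ?pnatr_eq0 //.
by rewrite gerBl invr_ge0 exprn_ge0.
Qed.
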